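(* Let $0<\Lambda_0<\Lambda_1$ be real numbers and let $\{\mathcal{M}_n\}_{n\in N}$ be a $(\Lambda_0,\Lambda_1)$-bounded matrix model that for all $r\in\mathbb{N}$ has an order $r$ expansion. For $i\in\mathbb{Z}_{\ge 0}$ let $c_i(k)$ be the $i$-th coefficient function of these expansions (which is independent of the order $r\ge i+1$ of the expansion), and let $p_i(k)$ denote the polyexponential part of $c_i(k)$ with respect to $\Lambda_0$. (1) If $p_i(k)=0$ for all $i\in\mathbb{Z}_{\ge 0}$, then for all $\epsilon>0$ and all $j\in\mathbb{Z}_{\ge 0}$, $$\mathbb{E}\mathrm{out}_{\mathcal{M}_n}\bigl[B_{\Lambda_0+\epsilon}(0)\bigr]=O(n^{-j}).$$ (2) Otherwise, let $j$ be the smallest integer for which $p_j(k)\neq 0$, and let $L=L_{j+1}$ be the (necessarily nonempty) set of bases of $p_j$. Then for all $\epsilon>0$, and for all $\theta>0$ sufficiently small, we have $$\mathbb{E}\mathrm{out}_{\mathcal{M}_n}\bigl[B_{\Lambda_0+\epsilon}(0)\cup B_{n^{-\theta}}(L_{j+1})\bigr]=o(n^{-j}).$$ Moreover, for each $\ell\in L$ there is a real $C_\ell>0$ such that $$p_j(k)=\sum_{\ell\in L}\ell^k C_\ell,$$ and for all $\ell\in L$, for sufficiently small $\theta>0$, $$\mathbb{E}\mathrm{in}_{\mathcal{M}_n}\bigl[B_{n^{-\theta}}(\ell)\bigr]=n^{-j}C_\ell+o(n^{-j}).$$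
   Context: Notation. $\mathbb{N}$ is the set of positive integers. For real $\rho\ge 0$ and $z\in\mathbb{C}$, $B_\rho(z)=\{x\in\mathbb{C}: |x-z|\le\rho\}$; for $L\subset\mathbb{C}$, $B_\rho(L)=\bigcup_{\ell\in L}B_\rho(\ell)$. Real intervals are viewed as subsets of $\mathbb{C}$. All probability spaces are finite with every atom of positive probability. $\mathbb{E}\mathrm{in}$ and $\mathbb{E}\mathrm{out}$. For a probability space $\mathcal{M}$ of square matrices and $R\subset\mathbb{C}$, $\mathbb{E}\mathrm{in}_{\mathcal{M}}[R]$ (respectively $\mathbb{E}\mathrm{out}_{\mathcal{M}}[R]$) is the expected number of eigenvalues of $M\in\mathcal{M}$, counted with multiplicity, that lie in $R$ (respectively not in $R$). Polyexponentials. A function $Q:\mathbb{N}\to\mathbb{C}$ is polyexponential if $Q(k)=\sum_{\ell\in L}p_\ell(k)\ell^k$ with $L\subset\mathbb{C}$ finite and $p_\ell$ polynomials, where for $\ell=0$ the expression $p_\ell(k)\ell^k$ means any function vanishing for $k$ sufficiently large. The representation is unique if $L$ is minimal (only nonzero terms are kept); the minimal $L$ is the set of bases of $Q$ and $p_\ell(k)\ell^k$ is the $\ell$-part of $Q$. A function $f:\mathbb{N}\to\mathbb{C}$ is of growth $\rho$ ($\rho\in\mathbb{R}$) if for every $\epsilon>0$, $|f(k)|<(\rho+\epsilon)^k$ for $k$ sufficiently large. An approximate polyexponential with error growth $\rho$ is a function $Q=f+g$ with $f$ polyexponential and $g$ of growth $\rho$; $f,g$ are uniquely determined if one insists that all bases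 of $f$ have absolute value greater than $\rho$; this $f$ is the polyexponential part of $Q$ with respect to $\rho$, and its bases are the larger bases of $Q$ with respect to $\rho$. Matrix models. Let $0<\Lambda_0<\Lambda_1$. A $(\Lambda_0,\Lambda_1)$-bounded matrix model is a collection of finite probability spaces $\{\mathcal{M}_n\}_{n\in N}$, with $N\subset\mathbb{N}$ infinite, where the atoms of $\mathcal{M}_n$ are $n\times n$ real-valued matrices whose eigenvalues lie in $B_{\Lambda_0}(0)\cup[-\Lambda_1,\Lambda_1]\subset\mathbb{C}$. For an integer $r\ge 0$ and $K:\mathbb{N}\to\mathbb{N}$ with $K(n)/\log n\to\infty$ as $n\to\infty$, the model has an order $r$ expansion with range $K(n)$ if $$\mathbb{E}_{M\in\mathcal{M}_n}[\mathrm{Trace}(M^k)]=c_0(k)+c_1(k)/n+\cdots+c_{r-1}(k)/n^{r-1}+O(c_r(k))/n^r$$ for all $n\in N$ and integers $k$ with $1\le k\le K(n)$, where (1) $c_r$ is of growth $\Lambda_1$; (2) the constant in $O(c_r(k))$ is independent of $k$ and $n$; (3) for $0\le i<r$, $c_i$ is an approximate polyexponential with error growth $\Lambda_0$ whose larger bases (with respect to $\Lambda_0$) lie in $[-\Lambda_1,\Lambda_1]$. ''Order $r$ expansion'' without a specified range means that this holds for some such $K$ (which may depend on $r$). For $i\le r-1$ the functions $c_i$ are uniquely determined by the model and do not depend on $r$. For an integer $i\ge 0$, $L_i$ denotes the union of the sets of larger bases (with respect to $\Lambda_0$) of $c_0,\ldots,c_{i-1}$. Asymptotics in $n$ are as $n\to\infty$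 with $n$ confined to $N$. *)

(* Defs.v *)
From mathcomp Require Export all_boot all_order all_algebra.
From mathcomp Require Export finmap.
From mathcomp Require Export complex.
From mathcomp Require Export all_classical all_reals all_analysis.
Export Order.TTheory GRing.Theory Num.Theory numFieldNormedType.Exports.

Set Implicit Arguments.
Unset Strict Implicit.
Unset Printing Implicit Defensive.

Local Open Scope classical_set_scope.
Local Open Scope complex_scope.
Local Open Scope ring_scope.

(* Functions on the positive integers are represented by functions on [nat]
   whose value at 0 is never used. *)

Definition cdisk (R : realType) (rho : R) (z : R[i]) : set R[i] :=
  [set x | `|x - z| <= rho%:C].

Definition cnbhd (R : realType) (rho : R) (L : set R[i]) : set R[i] :=
  \bigcup_(l in L) cdisk rho l.

Definition cinterval (R : realType) (a b : R) : set R[i] :=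
  [set x%:C | x in `[a, b]].

Record matrix_space (R : realType) (n : nat) := MatrixSpace {
  atoms : {fset 'M[R]_n};
  prob : 'M[R]_n -> R;
  prob_gt0 : forall A, A \in atoms -> 0 < prob A;
  prob_sum1 : \sum_(A <- atoms) prob A = 1
}.

Definition expectation (R : realType) (n : nat) (M : matrix_space R n)
    (X : 'M[R]_n -> R) : R :=
  \sum_(A <- atoms M) prob M A * X A.

Definition to_complex_mx (R : realType) (n : nat) (A : 'M[R]_n) : 'M[R[i]]_n :=
  map_mx (fun x : R => x%:C) A.

(* The roots of the characteristic polynomial, repeated according to their
   multiplicity. *)
Definition eigenvalues (R : realType) (n : nat) (A : 'M[R]_n) : seq R[i] :=
  sval (closed_field_poly_normal (char_poly (to_complex_mx A))).

Definition Ein (R : realType) (n : nat) (M : matrix_space R n) (S : set R[i]) :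
    R :=
  expectation M (fun A => (count (fun z => `[< S z >]) (eigenvalues A))%:R).

Definition Eout (R : realType) (n : nat) (M : matrix_space R n)
    (S : set R[i]) : R :=
  Ein M (~` S).

(* [t] is a term "p(k) l^k"; for [l = 0] it may be any function that vanishes
   for large k. *)
Definition polyexp_term (R : realType) (l : R[i]) (t : nat -> R[i]) : Prop :=
  if l == 0 then \forall k \near \oo, t k = 0
  else exists p : {poly R[i]},
    forall k, (0 < k)%N -> t k = p.[k%:R] * l ^+ k.

Definition polyexp_repr (R : realType) (f : nat -> R[i]) (L : {fset R[i]})
    (t : R[i] -> nat -> R[i]) : Prop :=
  (forall l, l \in L -> polyexp_term l (t l)) /\
  (forall k, (0 < k)%N -> f k = \sum_(l <- L) t l k).

Definition polyexponential (R : realType) (f : nat -> R[i]) : Prop :=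
  exists L t, polyexp_repr f L t.

(* [L] is the set of bases of the polyexponential [f]: it carries a
   representation of [f] in which no term is identically zero. *)
Definition bases (R : realType) (f : nat -> R[i]) (L : {fset R[i]}) : Prop :=
  exists t, polyexp_repr f L t /\
    (forall l, l \in L -> exists2 k, (0 < k)%N & t l k != 0).

Definition has_growth (R : realType) (rho : R) (f : nat -> R[i]) : Prop :=
  forall e : R, 0 < e -> \forall k \near \oo, `|f k| < ((rho + e) ^+ k)%:C.

Definition approx_polyexp (R : realType) (rho : R) (Q : nat -> R[i]) : Prop :=
  exists f g : nat -> R[i],
    [/\ polyexponential f, has_growth rho g &
        forall k, (0 < k)%N -> Q k = f k + g k].

Definition polyexp_part (R : realType) (rho : R) (Q f : nat -> R[i]) : Prop :=
  (exists2 L, bases f L & forall l, l \in L -> rho%:C < `|l|) /\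
  (exists2 g, has_growth rho g & forall k, (0 < k)%N -> Q k = f k + g k).

Definition larger_bases (R : realType) (rho : R) (Q : nat -> R[i]) :
    set R[i] :=
  [set l | exists f L, [/\ polyexp_part rho Q f, bases f L & l \in L]].

(* A model indexed by [N] is given by a family over all of [nat]; the spaces at
   indices outside [N] are irrelevant. *)
Definition bounded_model (R : realType) (La0 La1 : R) (N : set nat)
    (M : forall n, matrix_space R n) : Prop :=
  [/\ infinite_set N,
      (forall n, N n -> (0 < n)%N) &
      (forall n, N n -> forall A, A \in atoms (M n) ->
         forall z, eigenvalue (to_complex_mx A) z ->
           (cdisk La0 0 `|` cinterval (- La1) La1) z)].

Definition toinfty (N : set nat) : set_system nat := within N \oo.

Global Instance toinfty_filter (N : set nat) : Filter (toinfty N).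
Proof. exact: within_filter. Qed.

(* Only [c 0, ..., c r.-1] matter; the function [cr] bounding the error need not
   be the coefficient [c r] of an expansion of higher order. *)
Definition order_expansion (R : realType) (La0 La1 : R) (N : set nat)
    (M : forall n, matrix_space R n) (r : nat) (K : nat -> nat)
    (c : nat -> nat -> R[i]) (cr : nat -> R[i]) : Prop :=
  [/\ (exists D : R, forall n k, N n -> (1 <= k <= K n)%N ->
         `|(expectation (M n) (fun A => \tr (A ^+ k)))%:C
           - \sum_(i < r) c i k / n%:R ^+ i|
         <= D%:C * `|cr k| / n%:R ^+ r),
      has_growth La1 cr &
      (forall i, (i < r)%N -> approx_polyexp La0 (c i) /\
         larger_bases La0 (c i) `<=` cinterval (- La1) La1)].

Definition has_expansion (R : realType) (La0 La1 : R) (N : set nat)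
    (M : forall n, matrix_space R n) (r : nat) (c : nat -> nat -> R[i]) :
    Prop :=
  exists K cr,
    [/\ (forall n, (0 < n)%N -> (0 < K n)%N),
        (K n)%:R / ln (n%:R : R) @[n --> toinfty N] --> +oo &
        order_expansion La0 La1 N M r K c cr].

(* The order [r > i] is arbitrary: [c i] does not depend on it. *)
Definition coefficient (R : realType) (La0 La1 : R) (N : set nat)
    (M : forall n, matrix_space R n) (i : nat) (f : nat -> R[i]) : Prop :=
  exists r c, [/\ (i < r)%N, has_expansion La0 La1 N M r c &
                  forall k, (0 < k)%N -> f k = c i k].

Definition larger_bases_upto (R : realType) (rho : R)
    (c : nat -> nat -> R[i]) (i : nat) : set R[i] :=
  \bigcup_(h in [set h | (h < i)%N]) larger_bases rho (c h).

(* Main.v *)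
(* Testing the spectrum against [P(z) z^k] with [P] a fixed polynomial and [k] a
   multiple of [log n] turns the expansion of the mean traces into estimates on
   the mean number of eigenvalues.  With [P] an even power of the product of
   [z - l] over all larger bases [l] of the first [r] coefficients, the larger
   bases disappear from the expansion, and positivity of [P(z) z^k] on the real
   axis shows that, for [r] large, there are few eigenvalues away from the disk
   and from these bases.  With [P] vanishing to a high order (depending on
   theta) at all bases except [l0], where its value is 1, the mean number of
   eigenvalues near [l0], times [n^j], is asymptotic to [q(k)] for the
   polynomial [q] that describes the effect of [P] on the [l0]-part of [p_j].
   Comparing [k] with [k + 1] shows that [q] is constant, hence so is the
   polynomial factor of that part. *)

Require Import Defs.
From mathcomp Require Import ring lra spectral.

Set Implicit Arguments.
Unset Strict Implicit.
Unset Printing Implicit Defensive.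

Local Open Scope classical_set_scope.
Local Open Scope complex_scope.
Local Open Scope ring_scope.

(** At exponents [k] of order [log n], every fixed ratio [B ^+ k] behaves like a power of [n]. A
    ratio below 1 has to beat the number [n] of eigenvalues, most of which may lie in the small
    disk; this fixes the multiple of [log n]. The remainder of the expansion is then inflated by a
    fixed power of [n], which only a large order [r] outweighs. Raising [r] brings in further bases,
    so the test polynomial is chosen after [r], and theta after its degree. Positivity gives only
    upper bounds; near [l0] the count is therefore compared directly with the mean of
    [P(z) (z / l0)^k]. The comparison error contains the unknown count itself, but with a factor
    that tends to 0, so it can be absorbed. The limit of the scaled counts near [l] is the
    coefficient of [l^k] in [p_j]: nonnegative as a limit of counts, nonzero for a base of [p_j],
    and zero for a base that occurs only in a later coefficient. The last fact shrinks the excluded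
    set from all bases of the first [r] coefficients to [L_{j+1}]. *)

(** * Polynomials in the shift acting on exponential terms *)

Section ShiftOperators.
Variable F : idomainType.
Implicit Types (P Q s : {poly F}) (f g : nat -> F) (l : F).

(* The action on sequences of a polynomial in the shift [k |-> k + 1]. *)
Definition shift_op P f (k : nat) : F := \sum_(a < size P) P`_a * f (k + a)%N.

Definition expterm s l (k : nat) : F := s.[k%:R] * l ^+ k.

Lemma shift_op_widen P f k N : (size P <= N)%N ->
  shift_op P f k = \sum_(a < N) P`_a * f (k + a)%N.
Proof.
move=> leN; rewrite /shift_op.
rewrite (big_ord_widen N (fun a => P`_a * f (k + a)%N) leN) big_mkcond /=.
apply: eq_bigr => a _; case: ltnP => // h.
by rewrite nth_default // mul0r.
Qed.

Lemma eq_shift_op P f g k : (forall a, f (k + a)%N = g (k + a)%N) ->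
  shift_op P f k = shift_op P g k.
Proof. by move=> fg; apply: eq_bigr => a _; rewrite fg. Qed.

Lemma shift_op_sum P (I : Type) (r : seq I) (f : I -> nat -> F) k :
  shift_op P (fun k => \sum_(i <- r) f i k) k
  = \sum_(i <- r) shift_op P (f i) k.
Proof.
rewrite /shift_op exchange_big /=.
by apply: eq_bigr => a _; rewrite mulr_sumr.
Qed.

Lemma shift_opD P f g k :
  shift_op P (fun k => f k + g k) k = shift_op P f k + shift_op P g k.
Proof.
by rewrite /shift_op -big_split /=; apply: eq_bigr => a _; rewrite mulrDr.
Qed.

Lemma shift_opMr P f x k : shift_op P (fun k => f k * x) k = shift_op P f k * x.
Proof.
by rewrite /shift_op mulr_suml; apply: eq_bigr => a _; rewrite mulrA.
Qed.

Lemma shift_opMXsubC P l f k :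
  shift_op (P * ('X - l%:P)) f k = shift_op P (fun k => f k.+1 - l * f k) k.
Proof.
have szP : (size (P * ('X - l%:P))%R <= (size P).+1)%N.
  by rewrite (leq_trans (size_polyMleq _ _)) // size_XsubC addn2.
rewrite (shift_op_widen _ _ szP) /shift_op.
under eq_bigr do rewrite mulrBr coefB coefMX coefMC mulrBl.
rewrite sumrB big_ord_recl /= mul0r add0r.
under [X in X - _]eq_bigr do rewrite add0n /bump /= add1n addnS.
rewrite big_ord_recr /= nth_default // !mul0r addr0 -sumrB.
by apply: eq_bigr => a _; rewrite mulrBr mulrA.
Qed.

Lemma size_comp_XaddC s c : size (s \Po ('X + c%:P)) = size s.
Proof. by rewrite size_comp_poly2 // size_XaddC. Qed.

Lemma lead_coef_comp_XaddC s c : lead_coef (s \Po ('X + c%:P)) = lead_coef s.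
Proof.
by rewrite lead_coef_comp ?size_XaddC // lead_coefXaddC expr1n mulr1.
Qed.

Lemma size_diff_poly s : (size ((s \Po ('X + 1%:P)) - s)%R <= (size s).-1)%N.
Proof.
apply/leq_sizeP => i le_i; rewrite coefB.
have [->|s0] := eqVneq s 0; first by rewrite comp_poly0 coef0 subr0.
move: le_i; rewrite leq_eqVlt => /predU1P[<-|lt_i].
  have := lead_coef_comp_XaddC s 1.
  by rewrite !lead_coefE size_comp_XaddC => ->; rewrite subrr.
have le_i : (size s <= i)%N by rewrite (leq_trans _ lt_i) // leqSpred.
by rewrite !nth_default ?subr0 // size_comp_XaddC.
Qed.

(** The operator [f(k + 1) - l f(k)] turns [s(k) l^k] into [l (s(k + 1) - s(k)) l^k], so each factor
    ['X - l%:P] lowers the size of the polynomial by at least one. *)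
Lemma shift_op_expterm_XsubCX P s l m k : (size s <= m)%N ->
  shift_op (P * ('X - l%:P) ^+ m) (expterm s l) k = 0.
Proof.
elim: m s => [|m IHm] s.
  rewrite leqn0 size_poly_eq0 => /eqP ->.
  by rewrite /shift_op big1 // => a _; rewrite /expterm horner0 mul0r mulr0.
move=> szs; rewrite exprSr mulrA shift_opMXsubC.
rewrite (@eq_shift_op _ _ (expterm (l *: ((s \Po ('X + 1%:P)) - s)) l)).
  apply: IHm; rewrite (leq_trans (size_scale_leq _ _)) //.
  by rewrite (leq_trans (size_diff_poly s)) //; case: (size s) szs.
move=> a; rewrite /expterm hornerZ hornerD hornerN horner_comp hornerD hornerX hornerC.
by rewrite -natr1 exprS; ring.
Qed.

(** The operator keeps the base [l] and replaces the factor [s] by this polynomial, which is the [q]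
    of the overview when [P] is 1 at [l]. *)
Definition shift_coef P l s : {poly F} :=
  \sum_(a < size P) (P`_a * l ^+ a) *: (s \Po ('X + (a%:R)%:P)).

Lemma shift_op_expterm P s l k :
  shift_op P (expterm s l) k = expterm (shift_coef P l s) l k.
Proof.
rewrite /expterm /shift_coef /shift_op horner_sum mulr_suml.
apply: eq_bigr => a _; rewrite hornerZ horner_comp hornerD hornerX hornerC natrD exprD.
by ring.
Qed.

(** All translates of [s] share its leading coefficient, so the top coefficients add up to it times
    the sum of the [P_a l^a]. *)
Lemma coef_shift_coef P l s :
  (shift_coef P l s)`_(size s).-1 = lead_coef s * P.[l].
Proof.
rewrite coef_sum horner_coef mulr_sumr; apply: eq_bigr => a _.
rewrite coefZ -(lead_coef_comp_XaddC s a%:R) lead_coefE size_comp_XaddC.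
by rewrite mulrC.
Qed.

Lemma shift_coef_eq0 P l s : P.[l] != 0 -> shift_coef P l s = 0 -> s = 0.
Proof.
move=> Pl0 q0; have := coef_shift_coef P l s.
rewrite q0 coef0 => /esym/eqP; rewrite mulf_eq0 (negPf Pl0) orbF.
by rewrite lead_coef_eq0 => /eqP.
Qed.

(** As [P] is 1 at [l], the leading coefficient of [s] survives at its own index; a constant image
    thus leaves no room for a nonconstant [s]. *)
Lemma shift_coef_const P l s : P.[l] = 1 ->
  (size (shift_coef P l s) <= 1)%N ->
  s = (s`_0)%:P /\ shift_coef P l s = (s`_0)%:P.
Proof.
move=> Pl1 sz1; have := coef_shift_coef P l s; rewrite Pl1 mulr1 => cf.
have szs : (size s <= 1)%N.
  rewrite leqNgt; apply/negP => szs.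
  move: cf; rewrite nth_default; last first.
    by rewrite (leq_trans sz1) //; case: (size s) szs => [|[]].
  move/esym/eqP; rewrite lead_coef_eq0 => /eqP s0.
  by rewrite s0 size_poly0 in szs.
have sE := size1_polyC szs; split => //.
rewrite (size1_polyC sz1); congr (_%:P).
by move: cf; rewrite lead_coefE; case: (size s) szs => [|[]].
Qed.
End ShiftOperators.

(** * Moduli, and polynomials at large integers *)

Section PolyAtNat.
Variable R : realType.
Local Notation cabs := (@ComplexField.Normc.normc R).
Implicit Types (z w : R[i]) (q : {poly R[i]}).

(** The generic norm takes values in [R[i]]; [cabs] is its real-valued form, in which the estimates
    are carried out. *)
Lemma cabsE z : `|z| = (cabs z)%:C. Proof. by []. Qed.

Lemma cabs_ge0 z : 0 <= cabs z.
Proof. by rewrite -ler0c -cabsE. Qed.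

Lemma cabsD z w : cabs (z + w) <= cabs z + cabs w.
Proof. by rewrite -lecR rmorphD /= -!cabsE ler_normD. Qed.

Lemma cabsN z : cabs (- z) = cabs z.
Proof. by apply: complexI; rewrite -!cabsE normrN. Qed.

Lemma cabsB z w : cabs (z - w) <= cabs z + cabs w.
Proof. by rewrite -(cabsN w) cabsD. Qed.

Lemma cabs_distC z w : cabs (z - w) = cabs (w - z).
Proof. by rewrite -cabsN opprB. Qed.

Lemma cabsM z w : cabs (z * w) = cabs z * cabs w.
Proof. exact: ComplexField.Normc.normcM. Qed.

Lemma cabs0 : cabs 0 = 0. Proof. exact: ComplexField.Normc.normc0. Qed.
Lemma cabs1 : cabs 1 = 1. Proof. exact: ComplexField.Normc.normc1. Qed.

Lemma cabs_eq0 z : (cabs z == 0) = (z == 0).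
Proof. by apply/eqP/eqP => [/ComplexField.Normc.eq0_normc//|->]; exact: cabs0. Qed.

Lemma cabs_gt0 z : (0 < cabs z) = (z != 0).
Proof. by rewrite lt_def cabs_ge0 andbT cabs_eq0. Qed.

Lemma cabsV z : cabs z^-1 = (cabs z)^-1.
Proof. exact: ComplexField.Normc.normcV. Qed.

Lemma cabsX z k : cabs (z ^+ k) = cabs z ^+ k.
Proof.
by elim: k => [|k IHk]; rewrite ?expr0 ?cabs1 // !exprS cabsM IHk.
Qed.

Lemma cabs_real (x : R) : cabs x%:C = `|x|.
Proof. by rewrite /= expr0n /= addr0 sqrtr_sqr. Qed.

Lemma cabs_nat (n : nat) : cabs n%:R = n%:R.
Proof. by rewrite -[n%:R](rmorph_nat (real_complex R)) cabs_real ger0_norm. Qed.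

Lemma cabs_sum (I : Type) (r : seq I) (P : pred I) (f : I -> R[i]) :
  cabs (\sum_(i <- r | P i) f i) <= \sum_(i <- r | P i) cabs (f i).
Proof.
elim/big_rec2: _ => [|i y z _ le_yz]; first by rewrite cabs0.
by rewrite (le_trans (cabsD _ _)) // lerD2l.
Qed.

Lemma Re_le_cabs z : `|complex.Re z| <= cabs z.
Proof. by rewrite -lecR -cabsE normc_ge_Re. Qed.

Lemma poly_lower_bound q : q != 0 ->
  exists2 c : R, 0 < c & \forall k \near \oo, c <= cabs q.[k%:R].
Proof.
elim/poly_ind: q => [|q b IHq]; first by rewrite eqxx.
have [-> | q0 _] := eqVneq q 0.
  rewrite mul0r add0r polyC_eq0 => b0; exists (cabs b); rewrite ?cabs_gt0 //.
  by near=> k; rewrite hornerC.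
have [c c0 qc] := IHq q0; exists c => //.
near=> k; rewrite hornerMXaddC.
(* This threshold is where [c * k - cabs b] reaches [c]. *)
have k1 : 1 + cabs b / c <= k%:R by near: k; exact: nbhs_infty_ger.
have ck : c <= cabs q.[k%:R] by near: k.
have -> : q.[k%:R] * k%:R = (q.[k%:R] * k%:R + b) - b by rewrite addrK.
have := cabsB (q.[k%:R] * k%:R + b) b; rewrite addrK cabsM cabs_nat.
have : c * (1 + cabs b / c) <= cabs q.[k%:R] * k%:R.
  by apply: ler_pM => //; [exact: ltW | rewrite addr_ge0 ?divr_ge0 ?cabs_ge0 // ltW].
rewrite mulrDr mulr1 mulrCA divff ?gt_eqF // mulr1.
by move=> h1 h2; have := le_trans h1 h2; rewrite lerD2r.
Unshelve. all: by end_near. Qed.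

(** The filter is arbitrary because the lemma serves along all integers, along [n] in [N], and along
    the exponents [logk A n]. *)
Lemma poly_nat_small_eq0 (T : Type) (G : set_system T) {FG : ProperFilter G}
    (k : T -> nat) q : k @ G --> \oo ->
  (forall e : R, 0 < e -> \forall n \near G, cabs q.[(k n)%:R] < e) -> q = 0.
Proof.
move=> koo small; apply: contrapT => /eqP /poly_lower_bound[c c0 qc].
have : \forall n \near G, False.
  near=> n; have : cabs q.[(k n)%:R] < c by near: n; exact: small.
  by apply/negP; rewrite -leNgt; near: n; exact: (koo _ qc).
by move/filter_ex => [].
Unshelve. all: by end_near. Qed.

Lemma poly_nat_eq0 q : (forall k : nat, q.[k%:R] = 0) -> q = 0.
Proof.
move=> q0; apply: (@poly_nat_small_eq0 _ \oo _ id) => //.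
by move=> e e0; near=> k; rewrite q0 cabs0.
Unshelve. all: by end_near. Qed.

Lemma size_diff_poly_eq0 q : (q \Po ('X + 1%:P)) - q = 0 -> (size q <= 1)%N.
Proof.
move=> dq0.
have qk k : q.[k%:R] = q.[0].
  elim: k => // k <-; have /(congr1 (horner^~ k%:R)) := dq0.
  rewrite hornerD hornerN horner_comp hornerD hornerX hornerC horner0 natr1.
  by move/subr0_eq.
suff -> : q = (q.[0])%:P by exact: size_polyC_leq1.
apply/subr0_eq/poly_nat_eq0 => k.
by rewrite hornerD hornerN hornerC qk subrr.
Qed.
End PolyAtNat.

(** * Orders of magnitude in [n], and exponents of order [log n] *)

Section PowerBounds.
Variables (R : realType) (N : set nat).
Local Notation cabs := (@ComplexField.Normc.normc R).
Implicit Types (u v : nat -> R) (s t A B : R).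

Lemma toinfty_proper : infinite_set N -> ProperFilter (toinfty N).
Proof.
move=> Ninf; apply: Build_ProperFilter_ex => P [m _ mP].
apply: contrapT => NP; apply: Ninf; apply: (@sub_finite_set _ _ `I_m) => [n Nn|].
  rewrite /= ltnNge; apply/negP => mn; apply: NP; exists n; exact: mP.
exact: finite_II.
Qed.

Lemma toinfty_in : \forall n \near toinfty N, N n.
Proof. exact: withinT. Qed.

Lemma toinfty_cvg (P : nat -> Prop) : (\forall n \near \oo, P n) ->
  \forall n \near toinfty N, P n.
Proof. by move=> ?; apply: cvg_within. Qed.

Lemma toinfty_ge m : \forall n \near toinfty N, (m <= n)%N.
Proof. by apply: toinfty_cvg; exact: nbhs_infty_ge. Qed.

(** This is [u n = O(n ^ t)] with an explicit real exponent: products add exponents, so comparing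
    error terms becomes linear arithmetic. *)
Definition obnd u t := exists C : R,
  \forall n \near toinfty N, `|u n| <= C * n%:R `^ t.

Lemma obnd_ge0 u t : obnd u t -> exists2 C : R, 0 <= C &
  \forall n \near toinfty N, `|u n| <= C * n%:R `^ t.
Proof.
case=> C uC; exists (Num.max C 0); first by rewrite le_max lexx orbT.
near=> n; apply: (@le_trans _ _ (C * n%:R `^ t)); first by near: n.
by rewrite ler_wpM2r ?powR_ge0 // le_max lexx.
Unshelve. all: by end_near. Qed.

Lemma obnd_le v u t : (\forall n \near toinfty N, `|u n| <= `|v n|) ->
  obnd v t -> obnd u t.
Proof.
move=> uv [C vC]; exists C; near=> n.
by apply: (@le_trans _ _ `|v n|); near: n.
Unshelve. all: by end_near. Qed.

Lemma obndW s u t : s <= t -> obnd u s -> obnd u t.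
Proof.
move=> st /obnd_ge0[C C0 uC]; exists C; near=> n.
apply: (@le_trans _ _ (C * n%:R `^ s)); first by near: n.
rewrite ler_wpM2l // ler_powR // ler1n; near: n; exact: toinfty_ge.
Unshelve. all: by end_near. Qed.

Lemma obndD u v t : obnd u t -> obnd v t -> obnd (fun n => u n + v n) t.
Proof.
move=> [C uC] [D vD]; exists (C + D); near=> n.
by rewrite (le_trans (ler_normD _ _)) // mulrDl lerD //; near: n.
Unshelve. all: by end_near. Qed.

Lemma obndM u v s t : obnd u s -> obnd v t -> obnd (fun n => u n * v n) (s + t).
Proof.
move=> /obnd_ge0[C C0 uC] /obnd_ge0[D D0 vD]; exists (C * D); near=> n.
rewrite powRD; last first.
  by apply/implyP => _; rewrite pnatr_eq0 -lt0n; near: n; exact: toinfty_ge.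
by rewrite normrM mulrACA ler_pM //; near: n.
Unshelve. all: by end_near. Qed.

Lemma obnd_cst (c : R) : obnd (fun=> c) 0.
Proof. by exists `|c|; near=> n; rewrite powRr0 mulr1. Unshelve. all: by end_near. Qed.

Lemma obndMl (c : R) u t : obnd u t -> obnd (fun n => c * u n) t.
Proof. by move=> ut; rewrite -[t]add0r; apply: obndM => //; exact: obnd_cst. Qed.

Lemma obndX m u t : obnd u t -> obnd (fun n => u n ^+ m) (m%:R * t).
Proof.
move=> ut; elim: m => [|m IHm]; first by rewrite mul0r; exact: obnd_cst.
under eq_fun do rewrite exprS.
by rewrite -natr1 mulrDl mul1r addrC; exact: obndM.
Qed.

Lemma obnd_sum (I : eqType) (r : seq I) (f : I -> nat -> R) t :
  (forall i, i \in r -> obnd (f i) t) -> obnd (fun n => \sum_(i <- r) f i n) t.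
Proof.
elim: r => [|i r IHr] fr.
  by exists 0; near=> n; rewrite big_nil normr0 mul0r.
have -> : (fun n => \sum_(j <- i :: r) f j n)
    = (fun n => f i n + \sum_(j <- r) f j n).
  by apply/funext => n; rewrite big_cons.
apply: obndD; first by apply: fr; rewrite mem_head.
by apply: IHr => j jr; apply: fr; rewrite in_cons jr orbT.
Unshelve. all: by end_near. Qed.

Lemma obnd_powR t : obnd (fun n => n%:R `^ t) t.
Proof. by exists 1; near=> n; rewrite mul1r ger0_norm // powR_ge0.
Unshelve. all: by end_near. Qed.

Lemma obnd_natX (d : nat) : obnd (fun n => n%:R ^+ d) d%:R.
Proof. by exists 1; near=> n; rewrite mul1r ger0_norm // powR_mulrn.
Unshelve. all: by end_near. Qed.

Lemma obnd_natXV (d : nat) : obnd (fun n => n%:R ^- d) (- d%:R).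
Proof.
by exists 1; near=> n; rewrite mul1r ger0_norm ?invr_ge0 // powRN powR_mulrn.
Unshelve. all: by end_near. Qed.

Lemma obnd_id : obnd (fun n => n%:R) 1.
Proof. exact: (obnd_natX 1). Qed.

Lemma obnd_small u t (e : R) : t < 0 -> 0 < e -> obnd u t ->
  \forall n \near toinfty N, `|u n| <= e.
Proof.
move=> t0 e0 /obnd_ge0[C C0 uC]; near=> n.
have n0 : (0 < n)%N by near: n; exact: toinfty_ge.
apply: (@le_trans _ _ (C * n%:R `^ t)); first by near: n.
have t0' : 0 < - t by rewrite oppr_gt0.
rewrite -[t]opprK powRN ler_pdivrMr ?powR_gt0 ?ltr0n // mulrC -ler_pdivrMr //.
(* Written as a power, the claim [C / e <= n ^ (- t)] reduces to [n] exceeding a fixed number. *)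
have -> : C / e = ((C / e) `^ (- t)^-1) `^ (- t).
  by rewrite -powRrM mulVf ?gt_eqF // powRr1 // divr_ge0 // ltW.
rewrite ge0_ler_powR ?nnegrE ?powR_ge0 //; first exact: ltW.
near: n; apply: toinfty_cvg; exact: nbhs_infty_ger.
Unshelve. all: by end_near. Qed.

(* Even, so that the powers [x ^+ logk A n] of a real [x] are nonnegative. *)
Definition logk A (n : nat) : nat := (2 * (Num.truncn (A * ln (n%:R : R))).+1)%N.

Lemma logk_gt A n : 0 <= A -> (0 < n)%N -> 2 * A * ln n%:R < (logk A n)%:R.
Proof.
move=> A0 n0; rewrite /logk natrM -mulrA ltr_pM2l //.
exact: truncnS_gt.
Qed.

Lemma logk_le A n : 0 <= A -> (0 < n)%N ->
  (logk A n)%:R <= 2 * A * ln n%:R + 2.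
Proof.
move=> A0 n0; rewrite /logk natrM -[(Num.truncn _).+1]addn1 natrD mulrDr mulr1.
rewrite lerD2r -mulrA ler_pM2l //.
by rewrite truncn_le // mulr_ge0 // ln_ge0 // ler1n.
Qed.

(** [logk A n] differs from [2 A ln n] by at most 2, and [B ^ (2 A ln n)] equals [n ^ (2 A ln B)].
    For [B < 1] the exponent is negative, or zero when [A = 0]. *)
Lemma obnd_explogk A B (a : nat) : 0 <= A -> 0 < B ->
  obnd (fun n => B ^+ (logk A n + a)) (2 * A * ln B).
Proof.
move=> A0 B0; exists (expR (2 * `|ln B|) * B ^+ a); near=> n.
have n0 : (0 < n)%N by near: n; exact: toinfty_ge.
rewrite ger0_norm ?exprn_ge0 ?(ltW B0) // exprD [leRHS]mulrAC ler_pM2r ?exprn_gt0 //.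
rewrite -{1}(lnK B0) -expRM_natr /powR pnatr_eq0 gtn_eqF // -expRD ler_expR.
rewrite -lerBlDr.
have -> : ln B * (logk A n)%:R - 2 * A * ln B * ln n%:R
  = ((logk A n)%:R - 2 * A * ln n%:R) * ln B by ring.
apply: (le_trans (ler_norm _)); rewrite normrM ler_wpM2r //.
rewrite ger0_norm; first by have := logk_le A0 n0; lra.
by have := logk_gt A0 n0; lra.
Unshelve. all: by end_near. Qed.

(** The inequality [1 + x <= expR x] at [x = t ln n] bounds [ln n] by [n ^ t / t]. *)
Lemma obnd_logk A (a : nat) t : 0 <= A -> 0 < t ->
  obnd (fun n => (logk A n + a)%:R) t.
Proof.
move=> A0 t0.
apply: (@obnd_le (fun n => (2 * A / t) * n%:R `^ t + (2 + a%:R))).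
  near=> n; have n0 : (0 < n)%N by near: n; exact: toinfty_ge.
  rewrite !ger0_norm ?addr_ge0 ?mulr_ge0 ?powR_ge0 ?invr_ge0 ?(ltW t0) //.
  rewrite natrD addrA lerD2r (le_trans (logk_le A0 n0)) // lerD2r.
  rewrite -!mulrA !ler_wpM2l // -ler_pdivrMl ?invr_gt0 // invrK.
  rewrite /powR pnatr_eq0 gtn_eqF //.
  by apply: le_trans (expR_ge1Dx _); rewrite lerDr.
apply: obndD; first by apply: obndMl; exact: obnd_powR.
by apply: (obndW (ltW t0)); exact: obnd_cst.
Unshelve. all: by end_near. Qed.

Lemma obnd_poly_logk A (a : nat) t (q : {poly R[i]}) : 0 <= A -> 0 < t ->
  obnd (fun n => cabs q.[(logk A n + a)%:R]) t.
Proof.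
move=> A0; elim/poly_ind: q t => [|q b IHq] t t0.
  by exists 0; near=> n; rewrite horner0 cabs0 normr0 mul0r.
apply: (@obnd_le (fun n => cabs q.[(logk A n + a)%:R] * (logk A n + a)%:R + cabs b)).
  near=> n; rewrite hornerMXaddC !ger0_norm ?addr_ge0 ?mulr_ge0 ?cabs_ge0 //.
  by rewrite (le_trans (cabsD _ _)) // cabsM cabs_nat.
(* In the Horner step, half of the exponent pays for [q] and half for the factor [k]. *)
have t2 : 0 < t / 2 by rewrite divr_gt0.
apply: obndD; last by apply: (obndW (ltW t0)); exact: obnd_cst.
by rewrite [t]splitr; apply: obndM; [exact: IHq|exact: obnd_logk].
Unshelve. all: by end_near. Qed.

Lemma cvg_ln_toinfty : ln (n%:R : R) @[n --> toinfty N] --> +oo.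
Proof.
apply/cvgryPge => x; near=> n.
have n0 : (0 < n)%N by near: n; exact: toinfty_ge.
rewrite -[x]expRK ler_ln ?posrE ?expR_gt0 ?ltr0n //.
near: n; apply: toinfty_cvg; exact: nbhs_infty_ger.
Unshelve. all: by end_near. Qed.

Lemma logk_cvg A (a : nat) : 0 < A -> (logk A n + a)%N @[n --> toinfty N] --> \oo.
Proof.
move=> A0; apply/cvgnyPge => m; near=> n.
have n0 : (0 < n)%N by near: n; exact: toinfty_ge.
rewrite (@leq_trans (logk A n)) ?leq_addr // -(ler_nat R).
rewrite (le_trans _ (ltW (logk_gt (ltW A0) n0))) //.
rewrite -ler_pdivrMl ?mulr_gt0 //; near: n.
by move/cvgryPge: cvg_ln_toinfty; apply.
Unshelve. all: by end_near. Qed.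

(** Once [ln n >= 1], the exponent is at most [(2 A + 2 + a) ln n], so the growth condition on the
    range admits every multiple of [log n]. *)
Lemma logk_range A (a : nat) (K : nat -> nat) : 0 <= A ->
  ((K n)%:R / ln (n%:R : R)) @[n --> toinfty N] --> +oo ->
  \forall n \near toinfty N, (logk A n + a <= K n)%N.
Proof.
move=> A0 /cvgryPge /(_ (2 * A + (2 + a%:R))) Kn; near=> n.
have n0 : (0 < n)%N by near: n; exact: toinfty_ge.
have ln1 : 1 <= ln (n%:R : R).
  by near: n; move/cvgryPge: cvg_ln_toinfty; apply.
have : 2 * A + (2 + a%:R) <= (K n)%:R / ln n%:R by near: n.
rewrite ler_pdivlMr ?(lt_le_trans _ ln1) // -(ler_nat R) => hK.
rewrite (le_trans _ hK) // mulrDl natrD.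
have := logk_le A0 n0; have : 2 + a%:R <= (2 + a%:R) * ln (n%:R : R).
  by rewrite ler_peMr // addr_ge0.
lra.
Unshelve. all: by end_near. Qed.

End PowerBounds.

(** * Products that annihilate prescribed bases *)

Section Annihilator.
Variable F : fieldType.
Implicit Types (l x : F) (s : {poly F}) (L : seq F).

(** The predicate [p] covers both the product over all bases and the one that omits a single
    base. *)
Lemma shift_op_prod_eq0 L (p : pred F) l s m k : l \in L -> p l ->
  (size s <= m)%N ->
  shift_op (\prod_(x <- L | p x) ('X - x%:P) ^+ m) (expterm s l) k = 0.
Proof.
move=> lL pl szs; rewrite (big_rem l lL) pl /= mulrC.
exact: shift_op_expterm_XsubCX.
Qed.

Lemma horner_prod_XsubCX L (p : pred F) m x :
  (\prod_(l <- L | p l) ('X - l%:P) ^+ m).[x]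
  = \prod_(l <- L | p l) (x - l) ^+ m.
Proof.
rewrite horner_prod; apply: eq_bigr => l _.
by rewrite horner_exp hornerXsubC.
Qed.

Lemma horner_prod_neq0 L m x :
  (\prod_(l <- L | l != x) ('X - l%:P) ^+ m).[x] != 0.
Proof.
rewrite horner_prod_XsubCX; rewrite prodf_seq_neq0.
by apply/allP => l _; apply/implyP => lx; rewrite expf_neq0 // subr_eq0 eq_sym.
Qed.
End Annihilator.

(** * Growth rates and vanishing of exponential sums *)

Section Growth.
Variable R : realType.
Local Notation cabs := (@ComplexField.Normc.normc R).
Implicit Types (f g : nat -> R[i]) (rho : R) (P : {poly R[i]}).

Lemma has_growthP rho f : has_growth rho f <->
  forall e : R, 0 < e -> \forall k \near \oo, cabs (f k) < (rho + e) ^+ k.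
Proof.
split=> h e /h; apply: filterS => k; first by rewrite cabsE ltcR.
by rewrite cabsE ltcR.
Qed.

Lemma expr_small (C r e : R) : 0 <= C -> 0 <= r < 1 -> 0 < e ->
  \forall k \near \oo, C * r ^+ k < e.
Proof.
move=> C0 /andP[r0 r1] e0.
have h : (fun k => C * r ^+ k) @ \oo --> C * 0.
  by apply: cvgMr; apply: cvg_expr; rewrite ger0_norm.
rewrite mulr0 in h; exact: (cvgr_lt _ h).
Qed.

Lemma has_growthB rho f g : 0 <= rho -> has_growth rho f -> has_growth rho g ->
  has_growth rho (fun k => f k - g k).
Proof.
move=> rho0 /has_growthP hf /has_growthP hg; apply/has_growthP => e e0.
have e2 : 0 < e / 2 by rewrite divr_gt0.
have r0 : 0 < rho + e / 2 by rewrite ltr_wpDl.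
have re0 : 0 < rho + e by rewrite ltr_wpDl.
have small : \forall k \near \oo, 2 * ((rho + e / 2) / (rho + e)) ^+ k < 1.
  apply: expr_small => //; rewrite divr_ge0 ?(ltW r0) ?(ltW re0) //=.
  by rewrite ltr_pdivrMr // mul1r; lra.
near=> k.
apply: (le_lt_trans (cabsB _ _)).
apply: (@lt_trans _ _ (2 * (rho + e / 2) ^+ k)); last first.
  rewrite -[ltRHS]mul1r -ltr_pdivrMr ?exprn_gt0 // -mulrA -expr_div_n.
  by near: k.
by rewrite mulr2n mulrDl mul1r ltrD //; near: k; [exact: hf|exact: hg].
Unshelve. all: by end_near. Qed.

(** Stated for absolute values because the remainder of an expansion is controlled only through
    [cabs (cr k)], not as a sequence to which a shift operator applies. *)
Lemma has_growth_sum rho (b : nat -> R) (m : nat) f e : 0 <= rho -> 0 < e ->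
  (forall a, 0 <= b a) -> has_growth rho f ->
  exists2 C : R, 0 <= C &
    \forall k \near \oo, \sum_(a < m) b a * cabs (f (k + a)%N) <= C * (rho + e) ^+ k.
Proof.
move=> rho0 e0 b0 /has_growthP /(_ e e0) fe; have r0 : 0 < rho + e by rewrite ltr_wpDl.
exists (\sum_(a < m) b a * (rho + e) ^+ a).
  by apply: sumr_ge0 => a _; rewrite mulr_ge0 ?exprn_ge0 // ltW.
case: fe => k0 _ fe; exists k0 => // k /= k0k; rewrite mulr_suml.
apply: ler_sum => a _; rewrite -mulrA ler_wpM2l // -exprD addnC.
by rewrite ltW // fe //= (leq_trans k0k) // leq_addl.
Qed.

Lemma has_growth_shift_op rho P f e : 0 <= rho -> 0 < e -> has_growth rho f ->
  exists2 C : R, 0 <= C &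
    \forall k \near \oo, cabs (shift_op P f k) <= C * (rho + e) ^+ k.
Proof.
move=> rho0 e0 fg.
have [C C0 Cf] := has_growth_sum (size P) rho0 e0 (fun a => cabs_ge0 P`_a) fg.
exists C => //; apply: filterS Cf => k; apply: le_trans.
apply: (le_trans (cabs_sum _ _ _)); apply: ler_sum => a _.
by rewrite cabsM.
Qed.

(* Annihilating all the bases but one leaves a sequence [q(k) l^k], where [q]
   is a polynomial that vanishes only if the term at [l] does. *)
Lemma expterm_sum_growth (L : {fset R[i]}) (s : R[i] -> {poly R[i]}) rho f :
  0 <= rho -> (forall l, l \in L -> rho < cabs l) -> has_growth rho f ->
  (\forall k \near \oo, f k = \sum_(l <- L) expterm (s l) l k) ->
  forall l, l \in L -> s l = 0.
Proof.
move=> rho0 Lrho fgrow fE x xL.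
pose m := \max_(l <- L) size (s l).
pose P := \prod_(l <- L | l != x) ('X - l%:P) ^+ m.
have xrho := Lrho _ xL.
have x0 : 0 < cabs x by apply: le_lt_trans xrho.
apply: (@shift_coef_eq0 _ P x); first exact: horner_prod_neq0.
apply: (@poly_nat_small_eq0 _ _ \oo _ id) => // e e0.
(* Half the gap, so that [(rho + d) / cabs x] is still below 1. *)
pose d := (cabs x - rho) / 2.
have d0 : 0 < d by rewrite divr_gt0 // subr_gt0.
have [C C0 Pf] := has_growth_shift_op P rho0 d0 fgrow.
have small : \forall k \near \oo, C * ((rho + d) / cabs x) ^+ k < e.
  apply: expr_small => //; rewrite divr_ge0 ?addr_ge0 ?(ltW d0) ?(ltW x0) //=.
  by rewrite ltr_pdivrMr // mul1r /d; lra.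
have Pfk : \forall k \near \oo,
    shift_op P f k = expterm (shift_coef P x (s x)) x k.
  case: fE => k0 _ fE; exists k0 => // k /= k0k.
  rewrite (@eq_shift_op _ _ _ (fun k => \sum_(l <- L) expterm (s l) l k)); last first.
    by move=> a; rewrite fE //= (leq_trans k0k) // leq_addr.
  rewrite shift_op_sum (big_fsetD1 x) //= big1_fset ?addr0 ?shift_op_expterm //.
  move=> l; rewrite in_fsetD1 => /andP[lx lL] _.
  by apply: shift_op_prod_eq0 => //; rewrite /m (big_rem l lL) /= leq_maxl.
near=> k.
have : C * ((rho + d) / cabs x) ^+ k < e by near: k.
apply: le_lt_trans; rewrite expr_div_n mulrA ler_pdivlMr ?exprn_gt0 //.
rewrite -cabsX -cabsM.
have <- : shift_op P f k = (shift_coef P x (s x)).[k%:R] * x ^+ k by near: k.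
by near: k.
Unshelve. all: by end_near. Qed.

End Growth.

(** * Uniqueness of polyexponential parts and of their bases *)

Section Bases.
Variable R : realType.
Local Notation cabs := (@ComplexField.Normc.normc R).
Implicit Types (f g : nat -> R[i]) (rho : R) (L : {fset R[i]}).

(** Here [s] is 0 outside [L], so it determines [L], and two representations can be compared as
    functions of the base. *)
Definition poly_repr f L (s : R[i] -> {poly R[i]}) :=
  (forall l, (s l != 0) = (l \in L)) /\
  (forall k, (0 < k)%N -> f k = \sum_(l <- L) expterm (s l) l k).

Lemma poly_repr_incl f L s (U : {fset R[i]}) k : poly_repr f L s ->
  (L `<=` U)%fset -> (0 < k)%N -> f k = \sum_(l <- U) expterm (s l) l k.
Proof.
move=> [sL fE] LU k0; rewrite fE //; apply: big_fset_incl => // l _.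
by rewrite -sL negbK => /eqP ->; rewrite /expterm horner0 mul0r.
Qed.

(** The difference is eventually an exponential sum over the union of [L] and [L']; all its bases
    exceed [rho] while its growth is [rho], so every term vanishes. *)
Lemma poly_repr_uniq rho f f' g L L' s s' : 0 <= rho ->
  poly_repr f L s -> poly_repr f' L' s' ->
  (forall l, l \in L -> rho < cabs l) -> (forall l, l \in L' -> rho < cabs l) ->
  has_growth rho g -> (\forall k \near \oo, f k - f' k = g k) -> s = s'.
Proof.
move=> rho0 fs fs' Lrho L'rho ggrow gE.
pose U := (L `|` L')%fset.
have Urho l : l \in U -> rho < cabs l by case/fsetUP => [/Lrho|/L'rho].
have gU : \forall k \near \oo, g k = \sum_(l <- U) expterm (s l - s' l) l k.
  near=> k.
  have k0 : (0 < k)%N by near: k; exact: nbhs_infty_gt.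
  have <- : f k - f' k = g k by near: k.
  rewrite (poly_repr_incl fs (fsubsetUl _ L') k0).
  rewrite (poly_repr_incl fs' (fsubsetUr L _) k0) -sumrB.
  by apply: eq_bigr => l _; rewrite /expterm hornerD hornerN mulrBl.
have ss' := expterm_sum_growth rho0 Urho ggrow gU.
apply/funext => l; apply/subr0_eq.
have [/ss' //|] := boolP (l \in U).
rewrite in_fsetU negb_or -(proj1 fs) -(proj1 fs') !negbK => /andP[/eqP -> /eqP ->].
by rewrite subr0.
Unshelve. all: by end_near. Qed.

Lemma poly_repr_fset f f' L L' s : poly_repr f L s -> poly_repr f' L' s -> L = L'.
Proof. by move=> [sL _] [sL' _]; apply/fsetP => l; rewrite -sL sL'. Qed.

(* A representation of a polyexponential may have a term at the base 0, which
   vanishes for large arguments. *)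
Lemma bases_poly_repr f L : bases f L -> exists s f' t,
  [/\ poly_repr f' (L `\ 0)%fset s,
      forall k, (0 < k)%N -> f k = f' k + t k,
      \forall k \near \oo, t k = 0 &
      if 0 \in L then exists2 k, (0 < k)%N & t k != 0
      else forall k, (0 < k)%N -> t k = 0].
Proof.
move=> [t [[tL fE] tn0]].
have : forall l, exists s : {poly R[i]}, (s != 0) = (l \in (L `\ 0)%fset) /\
    (l \in (L `\ 0)%fset -> forall k, (0 < k)%N -> t l k = expterm s l k).
  move=> l; have [|] := boolP (l \in (L `\ 0)%fset); last first.
    by exists 0; rewrite eqxx.
  rewrite in_fsetD1 => /andP[l0 lL].
  have := tL _ lL; rewrite /polyexp_term (negPf l0) => -[s sE]; exists s.
  split=> //; have [k k0 tk] := tn0 _ lL.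
  by apply: contraNneq tk => s0; rewrite sE // s0 horner0 mul0r.
move/choice => [s sE].
exists s, (fun k => \sum_(l <- (L `\ 0)%fset) t l k),
  (fun k => if 0 \in L then t 0 k else 0); split.
- split=> [l|k k0]; first by case: (sE l).
  rewrite big_seq [RHS]big_seq; apply: eq_bigr => l lL.
  by have [_ sEl] := sE l; rewrite sEl.
- move=> k k0; rewrite fE //; case: ifPn => L0.
    by rewrite (big_fsetD1 0) //= addrC.
  rewrite addr0; suff -> : (L `\ 0)%fset = L by [].
  apply/fsetP => l; rewrite in_fsetD1; have [->|//] := eqVneq l 0.
  by rewrite (negPf L0).
- have [/tL|_] := boolP (0 \in L); last by near=> k.
  by rewrite /polyexp_term eqxx.
- by have [/tn0|] := boolP (0 \in L).
Unshelve. all: by end_near. Qed.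

Lemma has_growth_cst0 rho : 0 <= rho -> has_growth rho (fun=> 0 : R[i]).
Proof.
move=> rho0; apply/has_growthP => e e0; near=> k.
by rewrite cabs0 exprn_gt0 // ltr_wpDl.
Unshelve. all: by end_near. Qed.

Lemma fsetD1_id (K : choiceType) (A : {fset K}) x : x \notin A -> (A `\ x)%fset = A.
Proof.
move=> xA; apply/fsetP => y; rewrite in_fsetD1.
by have [->|//] := eqVneq y x; rewrite (negPf xA).
Qed.

(** Uniqueness at growth 0 identifies the nonzero bases. The sums over them then agree at every
    positive [k], not only at large ones, so a term at base 0 would be identically zero, against the
    minimality of [L']. *)
Lemma bases_uniq f L L' : 0 \notin L -> bases f L -> bases f L' -> L' = L.
Proof.
move=> L0 /bases_poly_repr[s [f1 [t [fs fE _]]]]; rewrite (negPf L0) => t0.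
case/bases_poly_repr => s' [f2 [t' [fs' fE' t'oo t'0]]].
have ss' : s = s'.
  apply: (poly_repr_uniq (lexx 0) fs fs' _ _ (has_growth_cst0 (lexx 0))).
  - by move=> l; rewrite in_fsetD1 cabs_gt0 => /andP[].
  - by move=> l; rewrite in_fsetD1 cabs_gt0 => /andP[].
  - near=> k; have k0 : (0 < k)%N by near: k; exact: nbhs_infty_gt.
    have t'k : t' k = 0 by near: k.
    by apply/eqP; rewrite subr_eq0 -[f2 k]addr0 -{1}t'k -fE' // fE // t0 // addr0.
rewrite -ss' in fs'; have LL' := poly_repr_fset fs fs'.
rewrite (fsetD1_id L0) in LL'; rewrite LL'.
have L'0 : 0 \notin L'.
  apply/negP => h; move: t'0; rewrite h => -[k k0 /eqP]; apply.
  apply/(addrI (f2 k)); rewrite -fE' // fE // t0 // !addr0.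
  by rewrite (proj2 fs) // (proj2 fs') // (fsetD1_id L0) LL'.
by rewrite fsetD1_id.
Unshelve. all: by end_near. Qed.

Lemma polyexp_part_repr rho Q p : 0 <= rho -> polyexp_part rho Q p ->
  exists L s g, [/\ bases p L, poly_repr p L s,
    forall l, l \in L -> rho < cabs l,
    has_growth rho g & forall k, (0 < k)%N -> Q k = p k + g k].
Proof.
move=> rho0 [[L pL Lrho] [g ggrow QE]].
have {}Lrho l : l \in L -> rho < cabs l by move/Lrho; rewrite cabsE ltcR.
have L0 : 0 \notin L by apply/negP => /Lrho; rewrite cabs0 ltNge rho0.
have [s [p' [t [ps pE _]]]] := bases_poly_repr pL.
rewrite (negPf L0) => t0; rewrite fsetD1_id // in ps.
exists L, s, g; split=> //; split=> [|k k0]; first exact: (proj1 ps).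
by rewrite pE // t0 // addr0; exact: (proj2 ps).
Qed.

(** [larger_bases] ranges over all polyexponential parts of [Q]; two of them differ by a sequence of
    growth [rho], so they all have the same bases. *)
Lemma larger_basesE rho Q p L : 0 <= rho -> polyexp_part rho Q p -> bases p L ->
  larger_bases rho Q = [set` L].
Proof.
move=> rho0 Qp pL; rewrite predeqE => l; split=> [|lL]; last first.
  by exists p, L.
case=> f [L' [Qf fL' lL']].
have [Lp [sp [gp [bp rp Lprho gprho QpE]]]] := polyexp_part_repr rho0 Qp.
have [Lf [sf [gf [bf rf Lfrho gfrho QfE]]]] := polyexp_part_repr rho0 Qf.
have nz (A : {fset R[i]}) : (forall x, x \in A -> rho < cabs x) -> 0 \notin A.
  by move=> h; apply/negP => /h; rewrite cabs0 ltNge rho0.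
have ff' : \forall k \near \oo, p k - f k = gf k - gp k.
  near=> k; have k0 : (0 < k)%N by near: k; exact: nbhs_infty_gt.
  have h := QfE k k0; rewrite QpE // in h.
  by have -> : p k = f k + gf k - gp k by [rewrite -h addrK]; ring.
have ss := poly_repr_uniq rho0 rp rf Lprho Lfrho (has_growthB rho0 gfrho gprho) ff'.
rewrite -ss in rf; have LL := poly_repr_fset rp rf.
rewrite /= (bases_uniq (nz Lp Lprho) bp pL) LL.
by rewrite -(bases_uniq (nz Lf Lfrho) bf fL').
Unshelve. all: by end_near. Qed.

End Bases.

(** * Traces of powers as power sums of eigenvalues *)

Section Trace.
Lemma trig_mxX (K : comNzRingType) (n : nat) (T : 'M[K]_n) k : is_trig_mx T ->
  is_trig_mx (T ^+ k) /\ forall i, (T ^+ k) i i = T i i ^+ k.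
Proof.
move=> /is_trig_mxP Ttrig; elim: k => [|k [/is_trig_mxP IHt IHd]].
  split=> [|i]; last by rewrite !expr0 mxE eqxx.
  by apply/is_trig_mxP => i j ij; rewrite expr0 mxE -val_eqE ltn_eqF.
split=> [|i]; rewrite ?exprS.
  apply/is_trig_mxP => i j ij; rewrite mxE big1 // => l _.
  have [il|li] := ltnP i l; first by rewrite Ttrig // mul0r.
  by rewrite IHt ?mulr0 // (leq_ltn_trans li).
rewrite mxE (bigD1 i) //= IHd big1 ?addr0 // => l li.
have [il|] := ltnP i l; first by rewrite Ttrig // mul0r.
rewrite leq_eqVlt => /predU1P[/val_inj li'|lti]; first by rewrite li' eqxx in li.
by rewrite IHt // mulr0.
Qed.

Lemma char_poly_similar (K : fieldType) (n : nat) (P A T : 'M[K]_n) :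
  P \in unitmx -> P *m A = T *m P -> char_poly A = char_poly T.
Proof.
move=> Pu PA; rewrite /char_poly.
have detP : \det (map_mx (@polyC K) P) != 0.
  by rewrite det_map_mx polyC_eq0 -unitfE.
apply: (mulfI detP); rewrite [RHS]mulrC -!det_mulmx; congr (\det _).
by rewrite /char_poly_mx mulmxBl mulmxBr scalar_mxC -!map_mxM PA.
Qed.

(** Schur triangularization: the diagonal of [T ^+ k] consists of the powers of the diagonal of [T],
    and that diagonal lists the eigenvalues since both split the same characteristic polynomial. *)
Lemma trace_exp_eigenvalues (R : realType) (n : nat) (A : 'M[R]_n) k : (0 < n)%N ->
  (\tr (A ^+ k))%:C = \sum_(z <- eigenvalues A) z ^+ k.
Proof.
move=> n0; have [P Pu] := Schur (to_complex_mx A) n0.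
set T := conjmx P (to_complex_mx A) => Ttrig.
have Pu' := unitarymx_unit Pu.
have PA : P *m to_complex_mx A = T *m P by apply/(similarP Pu'); exact: eqxx.
have PAk : P *m (to_complex_mx A ^+ k) = T ^+ k *m P.
  elim: k => [|k IHk]; first exact: etrans (mulmx1 _) (esym (mul1mx _)).
  by rewrite exprSr mulmxA IHk -mulmxA PA mulmxA exprSr.
have -> : (\tr (A ^+ k))%:C = \tr (to_complex_mx A ^+ k).
  have -> : to_complex_mx A ^+ k = to_complex_mx (A ^+ k).
    elim: k {PAk} => [|k IHk]; first by rewrite !expr0 /to_complex_mx map_mx1.
    by rewrite !exprS IHk /to_complex_mx map_mxM.
  by rewrite rmorph_sum; apply: eq_bigr => i _; rewrite mxE.
have [_ Tk] := trig_mxX k Ttrig.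
have -> : \tr (to_complex_mx A ^+ k) = \sum_i T i i ^+ k.
  have -> : to_complex_mx A ^+ k = invmx P *m (T ^+ k *m P) by rewrite -PAk mulKmx.
  by rewrite mxtrace_mulC mulmxK // /mxtrace; apply: eq_bigr => i _; rewrite Tk.
have perm : perm_eq [seq T i i | i : 'I_n] (eigenvalues A).
  apply: prod_XsubC_eq.
  rewrite big_image /= -char_poly_trig // -(char_poly_similar Pu' PA).
  rewrite /eigenvalues; case: closed_field_poly_normal => r /= rE.
  by rewrite [LHS]rE (monicP (char_poly_monic _)) scale1r.
by rewrite -(perm_big _ perm) big_image.
Qed.
End Trace.

(** * Mean sums of test functions over the spectrum *)

Section SpectralSums.
Variables (R : realType) (n : nat) (M : matrix_space R n).
Local Notation cabs := (@ComplexField.Normc.normc R).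
Implicit Types (F G : R[i] -> R) (H : R[i] -> R[i]) (S : set R[i]).

(** With an indicator function this is [Ein], so bounds on eigenvalue counts become pointwise
    inequalities on the spectrum. The complex version below accommodates the test functions
    [P(z) z^k]. *)
Definition spec_mean F : R :=
  expectation M (fun A => \sum_(z <- eigenvalues A) F z).

Definition cspec_mean H : R[i] :=
  \sum_(A <- atoms M) (prob M A)%:C * \sum_(z <- eigenvalues A) H z.

Lemma eigenvaluesE (A : 'M[R]_n) :
  char_poly (to_complex_mx A) = \prod_(z <- eigenvalues A) ('X - z%:P).
Proof.
rewrite /eigenvalues; case: closed_field_poly_normal => r /= {1}->.
by rewrite (monicP (char_poly_monic _)) scale1r.
Qed.

Lemma size_eigenvalues (A : 'M[R]_n) : size (eigenvalues A) = n.
Proof.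
apply: succn_inj; rewrite -(size_char_poly (to_complex_mx A)) eigenvaluesE.
by rewrite size_prod_XsubC.
Qed.

Lemma mem_eigenvalues (A : 'M[R]_n) z :
  (z \in eigenvalues A) = eigenvalue (to_complex_mx A) z.
Proof. by rewrite eigenvalue_root_char eigenvaluesE root_prod_XsubC. Qed.

Lemma Ein_spec_mean S : Ein M S = spec_mean (fun z => (`[< S z >])%:R).
Proof.
rewrite /Ein /spec_mean; congr expectation; apply/funext => A.
by rewrite -sum1_count big_mkcond natr_sum /=; apply: eq_bigr => z _; case: ifP.
Qed.

Lemma le_spec_mean F G :
  (forall A, A \in atoms M -> forall z, eigenvalue (to_complex_mx A) z -> F z <= G z) ->
  spec_mean F <= spec_mean G.
Proof.
move=> FG; rewrite /spec_mean /expectation big_seq [leRHS]big_seq.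
apply: ler_sum => A AM; rewrite ler_wpM2l ?(ltW (prob_gt0 AM)) //.
rewrite big_seq [leRHS]big_seq; apply: ler_sum => z.
by rewrite mem_eigenvalues; apply: FG.
Qed.

Lemma spec_meanD F G : spec_mean (fun z => F z + G z) = spec_mean F + spec_mean G.
Proof.
rewrite /spec_mean /expectation -big_split /=; apply: eq_bigr => A _.
by rewrite big_split mulrDr.
Qed.

Lemma spec_meanZ c F : spec_mean (fun z => c * F z) = c * spec_mean F.
Proof.
rewrite /spec_mean /expectation mulr_sumr; apply: eq_bigr => A _.
by rewrite -mulr_sumr mulrCA.
Qed.

Lemma spec_mean_cst c : spec_mean (fun=> c) = c * n%:R.
Proof.
rewrite /spec_mean /expectation.
under eq_bigr do
  rewrite big_const_seq count_predT size_eigenvalues iter_addr_0 -mulr_natr.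
by rewrite -mulr_suml prob_sum1 mul1r.
Qed.

Lemma Ein_ge0 S : 0 <= Ein M S.
Proof.
rewrite Ein_spec_mean -(mul0r n%:R) -spec_mean_cst.
by apply: le_spec_mean => A _ z _; rewrite ler0n.
Qed.

Lemma Re_sum (I : Type) (r : seq I) (f : I -> R[i]) :
  complex.Re (\sum_(i <- r) f i) = \sum_(i <- r) complex.Re (f i).
Proof.
elim/big_rec2: _ => // i x y _ <-.
by case: (f i) => ? ?; case: y.
Qed.

Lemma Re_cspec_mean H :
  complex.Re (cspec_mean H) = spec_mean (fun z => complex.Re (H z)).
Proof.
rewrite /cspec_mean /spec_mean /expectation Re_sum; apply: eq_bigr => A _.
rewrite -Re_sum; case: (\sum_(z <- _) _) => a b /=.
by rewrite mul0r subr0.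
Qed.

Lemma cabs_cspec_mean H : cabs (cspec_mean H) <= spec_mean (fun z => cabs (H z)).
Proof.
rewrite /cspec_mean /spec_mean /expectation (le_trans (cabs_sum _ _ _)) //.
rewrite big_seq [leRHS]big_seq; apply: ler_sum => A AM.
have pA := ltW (prob_gt0 AM).
by rewrite cabsM cabs_real ger0_norm // ler_wpM2l // cabs_sum.
Qed.

Lemma cspec_meanB H H' :
  cspec_mean (fun z => H z - H' z) = cspec_mean H - cspec_mean H'.
Proof.
rewrite /cspec_mean -sumrB; apply: eq_bigr => A _.
by rewrite sumrB mulrBr.
Qed.

Lemma cspec_meanZ c H : cspec_mean (fun z => c * H z) = c * cspec_mean H.
Proof.
rewrite /cspec_mean mulr_sumr; apply: eq_bigr => A _.
by rewrite -mulr_sumr mulrCA.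
Qed.

Lemma cspec_mean_real F :
  cspec_mean (fun z => (F z)%:C) = (spec_mean F)%:C.
Proof.
rewrite /cspec_mean /spec_mean /expectation rmorph_sum; apply: eq_bigr => A _.
by rewrite rmorphM rmorph_sum.
Qed.

(** The monomial of degree [a] of [P] contributes the trace of [A ^+ (k + a)]: testing the spectrum
    with [P(z) z^k] is shifting the mean traces by [P]. *)
Lemma cspec_mean_poly (P : {poly R[i]}) k : (0 < n)%N ->
  cspec_mean (fun z => P.[z] * z ^+ k)
  = shift_op P (fun k => (expectation M (fun A => \tr (A ^+ k)))%:C) k.
Proof.
move=> n0; rewrite /shift_op /cspec_mean /expectation.
under [RHS]eq_bigr do rewrite rmorph_sum mulr_sumr.
rewrite exchange_big; apply: eq_bigr => A _ /=.
under [RHS]eq_bigr do rewrite rmorphM /= trace_exp_eigenvalues // mulrCA.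
rewrite -mulr_sumr; congr (_ * _).
under [RHS]eq_bigr do rewrite mulr_sumr.
rewrite exchange_big; apply: eq_bigr => z _ /=.
rewrite horner_coef mulr_suml; apply: eq_bigr => a _.
by rewrite exprD mulrCA mulrC mulrA.
Qed.

End SpectralSums.

(** * Uniqueness of the expansion coefficients *)

Section Coefficients.
Variables (R : realType) (La0 La1 : R) (N : set nat) (M : forall n, matrix_space R n).
Local Notation cabs := (@ComplexField.Normc.normc R).
Implicit Types (c : nat -> nat -> R[i]).
Hypothesis Ninf : infinite_set N.

Definition mean_trace n k : R := expectation (M n) (fun A => \tr (A ^+ k)).

Lemma natrXVC n i : (n%:R ^+ i : R[i])^-1 = (((n%:R : R) ^+ i)^-1)%:C.
Proof. by rewrite fmorphV rmorphXn rmorph_nat. Qed.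

Lemma cabs_divnX (z : R[i]) n i : cabs (z / n%:R ^+ i) = cabs z / n%:R ^+ i.
Proof. by rewrite cabsM cabsV cabsX cabs_nat. Qed.

Lemma order_expansion_bound r K c cr : order_expansion La0 La1 N M r K c cr ->
  exists2 D : R, 0 <= D & forall n k, N n -> (1 <= k <= K n)%N ->
    cabs ((mean_trace n k)%:C - \sum_(i < r) c i k / n%:R ^+ i)
    <= D * cabs (cr k) / n%:R ^+ r.
Proof.
case=> -[D hD] _ _; exists `|D| => // n k Nn kK.
have := hD n k Nn kK; rewrite natrXVC !cabsE -!rmorphM lecR => /le_trans; apply.
by rewrite -!mulrA ler_wpM2r ?ler_norm // mulr_ge0 ?cabs_ge0 ?invr_ge0 ?exprn_ge0.
Qed.

Lemma expansion_obnd r r' c k : (0 < k)%N -> (r' <= r)%N ->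
  has_expansion La0 La1 N M r c ->
  obnd N (fun n => cabs ((mean_trace n k)%:C - \sum_(i < r') c i k / n%:R ^+ i))
    (- r'%:R).
Proof.
move=> k0 r'r [K [cr [_ Koo oexp]]].
have [D D0 Dbound] := order_expansion_bound oexp.
apply: (@obnd_le _ _ (fun n => D * cabs (cr k) * n%:R ^- r
    + \sum_(i <- index_enum 'I_r | (r' <= i)%N) cabs (c i k) * n%:R ^- i)).
  near=> n.
  have Nn : N n by near: n; exact: toinfty_in.
  have kK : (k <= K n)%N.
    (* With [A = 0] and offset [k], this says that a fixed [k] is eventually in range. *)
    near: n; have := @logk_range R N 0 k K (lexx _) Koo.
    by apply: filterS => n; apply: leq_trans; rewrite leq_addl.
  rewrite !ger0_norm ?cabs_ge0 //; last first.
    rewrite addr_ge0 ?mulr_ge0 ?cabs_ge0 ?invr_ge0 ?exprn_ge0 //.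
    by apply: sumr_ge0 => i _; rewrite mulr_ge0 ?cabs_ge0 ?invr_ge0 ?exprn_ge0.
  have Dnk := Dbound n k Nn; rewrite k0 kK in Dnk.
  have -> : \sum_(i < r') c i k / n%:R ^+ i
    = \sum_(i < r) c i k / n%:R ^+ i - \sum_(i < r | (r' <= i)%N) c i k / n%:R ^+ i.
    rewrite (bigID (fun i : 'I_r => (r' <= i)%N)) /= addrC addrK.
    rewrite (big_ord_widen r (fun i => c i k / n%:R ^+ i) r'r).
    by apply: eq_bigl => i; rewrite -ltnNge.
  rewrite opprB addrCA [_ + (_ - _)]addrC.
  apply: (le_trans (cabsD _ _)); apply: lerD; first exact: Dnk.
  apply: (le_trans (cabs_sum _ _ _)); apply: ler_sum => i _.
  by rewrite cabs_divnX.
apply: obndD.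
  apply: obndMl; apply: (@obndW _ _ (- r%:R)); last exact: obnd_natXV.
  by rewrite lerN2 ler_nat.
under eq_fun do rewrite big_mkcond.
apply: obnd_sum => i _; have [r'i|_] := leqP r' i; last first.
  by exists 0; near=> n; rewrite normr0 mul0r.
apply: obndMl; apply: (@obndW _ _ (- i%:R)); last exact: obnd_natXV.
by rewrite lerN2 ler_nat.
Unshelve. all: by end_near. Qed.

(** For fixed [k], the difference of the two expansions truncated at order [r] is [O(n^-r)].
    Multiplied by [n^(r - 1)] it is a polynomial in [n], with the coefficients in reverse order,
    that tends to 0 along [N]; hence it is zero. *)
Lemma expansion_uniq r1 r2 c1 c2 i k : (0 < k)%N -> (i < r1)%N -> (i < r2)%N ->
  has_expansion La0 La1 N M r1 c1 -> has_expansion La0 La1 N M r2 c2 ->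
  c1 i k = c2 i k.
Proof.
move=> k0 i1 i2 h1 h2; pose r := minn r1 r2.
have ir : (i < r)%N by rewrite leq_min i1.
have o1 := expansion_obnd k0 (geq_minl r1 r2) h1.
have o2 := expansion_obnd k0 (geq_minr r1 r2) h2.
rewrite -/r in o1 o2.
pose d i := c1 i k - c2 i k.
pose q : {poly R[i]} := \poly_(i < r) d (r.-1 - i)%N.
have qE n : (0 < n)%N ->
    q.[n%:R] = n%:R ^+ r.-1 * \sum_(i < r) d i / n%:R ^+ i.
  move=> n0; rewrite /q horner_poly (reindex_inj rev_ord_inj) mulr_sumr /=.
  apply: eq_bigr => -[a /= ar] _.
  have ar' : (a <= r.-1)%N by rewrite -ltnS (ltn_predK ar).
  have -> : (r - a.+1 = r.-1 - a)%N by case: (r) ar.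
  rewrite subKn // mulrCA; congr (_ * _).
  rewrite -{2}(subnK ar') exprD mulfK // expf_neq0 // pnatr_eq0 -lt0n //.
suff q0 : q = 0.
  have := congr1 (fun u : {poly R[i]} => u`_(r.-1 - i)) q0.
  have ir' : (i <= r.-1)%N by rewrite -ltnS (ltn_predK ir).
  rewrite coef0 coef_poly subKn // (leq_ltn_trans (leq_subr _ _)) ?(ltn_predK ir) //.
  by move/subr0_eq.
have PF := toinfty_proper Ninf.
apply: (@poly_nat_small_eq0 R _ (toinfty N) _ id).
  exact: cvg_within.
move=> e e0.
have : obnd N (fun n => cabs q.[n%:R]) (-1).
  have := obndM (obnd_natX R N r.-1) (obndD o1 o2).
  have -> : r.-1%:R - r%:R = -1 :> R.
    by rewrite -{2}(ltn_predK ir) -natr1 opprD addrA subrr add0r.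
  apply: obnd_le; near=> n; have n0 : (0 < n)%N by near: n; exact: toinfty_ge.
  rewrite qE // cabsM cabsX cabs_nat !normrM ler_wpM2l //.
  rewrite !ger0_norm ?addr_ge0 ?cabs_ge0 //.
  have -> : \sum_(i < r) d i / n%:R ^+ i =
     ((mean_trace n k)%:C - \sum_(i < r) c2 i k / n%:R ^+ i)
     - ((mean_trace n k)%:C - \sum_(i < r) c1 i k / n%:R ^+ i).
    rewrite opprB addrC addrA subrK -sumrB; apply: eq_bigr => a _.
    by rewrite /d mulrBl.
  by rewrite [leRHS]addrC cabsB.
have e2 : 0 < e / 2 by rewrite divr_gt0.
move/(obnd_small _ e2); rewrite oppr_lt0 => /(_ ltr01).
apply: filterS => n; rewrite ger0_norm ?cabs_ge0 // => /le_lt_trans; apply.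
by rewrite ltr_pdivrMr // mulr2n mulrDr mulr1 ltrDl.
Unshelve. all: by end_near. Qed.

End Coefficients.

(** * Pointwise bounds for the test polynomials *)

Section ComplexBounds.
Variable R : realType.
Local Notation cabs := (@ComplexField.Normc.normc R).
Implicit Types (z l : R[i]) (P : {poly R[i]}).

Lemma poly_disk_cabs P (rho : R) :
  exists2 C : R, 0 <= C & forall z, cabs z <= rho -> cabs P.[z] <= C.
Proof.
have [ub ubP] := poly_disk_bound P rho%:C.
exists (cabs ub) => [|z zr]; first exact: cabs_ge0.
have Pz : `|P.[z]| <= ub by apply: ubP; rewrite cabsE lecR.
by rewrite -lecR -!cabsE [leRHS]ger0_norm // (le_trans _ Pz).
Qed.

(** Induction gives the bound [(1 + d)^k k d], and [k d <= 1] bounds [(1 + d)^k] by [expR 1]. *)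
Lemma cabs_exprB1 z k (d : R) : cabs (z - 1) <= d -> k%:R * d <= 1 ->
  cabs (z ^+ k - 1) <= expR 1 * (k%:R * d).
Proof.
move=> zd kd1; have d0 : 0 <= d by apply: le_trans zd; exact: cabs_ge0.
have zd1 : cabs z <= 1 + d.
  by rewrite -[z](subrK 1) addrC (le_trans (cabsD _ _)) // cabs1 lerD2l.
suff h i : cabs (z ^+ i - 1) <= (1 + d) ^+ i * (i%:R * d).
  apply: (le_trans (h k)); rewrite ler_wpM2r ?mulr_ge0 //.
  apply: (@le_trans _ _ (expR d ^+ k)).
    by rewrite lerXn2r ?nnegrE ?expR_ge0 ?addr_ge0 // expR_ge1Dx.
  by rewrite -expRM_natl ler_expR.
elim: i => [|i IHi]; first by rewrite expr0 subrr cabs0 mul0r mulr0.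
have -> : z ^+ i.+1 - 1 = z * (z ^+ i - 1) + (z - 1) by rewrite exprS; ring.
apply: (le_trans (cabsD _ _)); rewrite cabsM -natr1 mulrDl mul1r mulrDr.
apply: lerD.
  by rewrite exprS -mulrA ler_pM ?cabs_ge0.
apply: (le_trans zd); rewrite ler_peMl // exprn_ege1 // lerDl //.
Qed.

Lemma cdiskE (rho : R) z : cdisk rho z = [set x | cabs (x - z) <= rho].
Proof. by apply/seteqP; split=> x; rewrite /cdisk /= cabsE lecR. Qed.

Lemma Im0E z : complex.Im z = 0 -> z = (complex.Re z)%:C.
Proof. by case: z => a b /= ->. Qed.

Lemma normr_even (x : R) k : ~~ odd k -> `|x| ^+ k = x ^+ k.
Proof. by move=> kev; rewrite -normrX ger0_norm // exprn_even_ge0. Qed.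

Lemma prodr_const_seq (T : Type) (r : seq T) (x : R) :
  \prod_(i <- r) x = x ^+ size r.
Proof. by rewrite big_const_seq count_predT iter_mulr_1. Qed.

(* At a real point, the polynomial below is a product of even powers. *)
Lemma even_prod_lower_bound (L : {fset R[i]}) m k (x d rho : R) :
  (forall l, l \in L -> complex.Im l = 0) -> ~~ odd k -> 0 <= d -> 0 <= rho ->
  let v := complex.Re ((\prod_(l <- L) ('X - l%:P) ^+ (2 * m)).[x%:C] * x%:C ^+ k) in
  0 <= v /\ ((forall l, l \in L -> d <= cabs (x%:C - l)) -> rho <= `|x| ->
    d ^+ (2 * m * size L) * rho ^+ k <= v).
Proof.
move=> Lreal kev d0 rho0.
have -> : (\prod_(l <- L) ('X - l%:P) ^+ (2 * m)).[x%:C] * x%:C ^+ k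
    = (\prod_(l <- L) `|x - complex.Re l| ^+ (2 * m) * `|x| ^+ k)%:C.
  rewrite rmorphM rmorph_prod horner_prod_XsubCX big_seq [in RHS]big_seq.
  rewrite rmorphXn /=; congr (_ * _); last by rewrite -!rmorphXn normr_even.
  apply: eq_bigr => l lL; rewrite {1}(Im0E (Lreal l lL)) -rmorphB -rmorphXn /=.
  by rewrite normr_even // oddM.
rewrite /=; split=> [|far rx].
  by rewrite mulr_ge0 ?exprn_ge0 // prodr_ge0 // => l _; rewrite exprn_ge0.
rewrite ler_pM ?exprn_ge0 //; last by rewrite lerXn2r ?nnegrE.
rewrite exprM -(prodr_const_seq L) big_seq [leRHS]big_seq.
apply: ler_prod => l lL; rewrite exprn_ge0 //= lerXn2r ?nnegrE //.
by have := far l lL; rewrite {1}(Im0E (Lreal l lL)) -rmorphB cabs_real.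
Qed.

(** The order [m] has two duties: it annihilates the terms at the other bases, and it makes the
    value [O(d ^ m)] within distance [d] of them. *)
Definition peak_poly (L : {fset R[i]}) (l0 : R[i]) (m : nat) : {poly R[i]} :=
  let P := \prod_(l <- L | l != l0) ('X - l%:P) ^+ m in P.[l0]^-1 *: P.

Lemma peak_poly1 L l0 m : (peak_poly L l0 m).[l0] = 1.
Proof. by rewrite /peak_poly hornerZ mulVf // horner_prod_neq0. Qed.

Lemma horner_sub1 P l0 : P.[l0] = 1 ->
  exists Q : {poly R[i]}, forall z, P.[z] - 1 = Q.[z] * (z - l0).
Proof.
move=> Pl0; have /factor_theorem[Q QE] : root (P - 1%:P) l0.
  by rewrite rootE hornerD hornerN hornerC Pl0 subrr.
exists Q => z; have := congr1 (horner^~ z) QE.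
by rewrite hornerM hornerD hornerN hornerC hornerXsubC.
Qed.

Lemma peak_poly_dvd L l0 m l : l \in L -> l != l0 ->
  exists P, peak_poly L l0 m = P * ('X - l%:P) ^+ m.
Proof.
move=> lL ll0; rewrite /peak_poly; move: (_^-1) => u.
by rewrite (big_rem l lL) ll0 /= mulrC scalerAl; eexists.
Qed.

(** The constant depends on [m], hence later on theta, but not on [z], [k] or [d]; so [k] may grow
    and [d] shrink with [n]. *)
Lemma peak_poly_bound L l0 m (rad : R) : l0 != 0 ->
  exists2 C : R, 0 <= C & forall z, cabs z <= rad -> let P := peak_poly L l0 m in
    [/\ cabs P.[z] <= C,
        (forall l, l \in L -> l != l0 -> cabs P.[z] <= C * cabs (z - l) ^+ m) &
        forall k (d : R), cabs (z - l0) <= d -> k%:R * (d / cabs l0) <= 1 ->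
          cabs (1 - P.[z] * (z / l0) ^+ k) <= C * (k.+1%:R * d)].
Proof.
move=> l00; set P := peak_poly L l0 m.
have al0 : 0 < cabs l0 by rewrite cabs_gt0.
have [C1 C10 C1P] := poly_disk_cabs P rad.
have [P3 P3E] := horner_sub1 (peak_poly1 L l0 m).
have [C3 C30 C3P] := poly_disk_cabs P3 rad.
have /choice[C2 C2P] : forall l, exists C : R, 0 <= C /\
    (l \in L -> l != l0 -> forall z, cabs z <= rad ->
      cabs P.[z] <= C * cabs (z - l) ^+ m).
  move=> l; have [lL|_] := boolP (l \in L); last by exists 0.
  have [_|ll0] := eqVneq l l0; first by exists 0.
  have [P2 P2E] := peak_poly_dvd m lL ll0.
  have [C C0 CP] := poly_disk_cabs P2 rad.
  exists C; split=> // _ _ z zr; rewrite /P P2E hornerM horner_exp hornerXsubC.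
  by rewrite cabsM cabsX ler_wpM2r ?exprn_ge0 ?cabs_ge0 // CP.
have C2s : 0 <= \sum_(l <- L) C2 l by apply: sumr_ge0 => l _; case: (C2P l).
pose C4 := C1 * (expR 1 / cabs l0).
have C40 : 0 <= C4 by rewrite mulr_ge0 ?mulr_ge0 ?expR_ge0 ?invr_ge0 ?cabs_ge0.
exists (C1 + C3 + C4 + \sum_(l <- L) C2 l); first by rewrite !addr_ge0.
move=> z zr /=; split.
- apply: (le_trans (C1P z zr)); lra.
- move=> l lL ll0; have [_ /(_ lL ll0 z zr) h] := C2P l.
  apply: (le_trans h); rewrite ler_wpM2r ?exprn_ge0 ?cabs_ge0 //.
  apply: (@le_trans _ _ (\sum_(l <- L) C2 l)); last by rewrite lerDr !addr_ge0.
  rewrite (big_rem l lL) /= lerDl; apply: sumr_ge0 => x _.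
  by case: (C2P x).
move=> k d zd kd; have d0 : 0 <= d by apply: le_trans zd; exact: cabs_ge0.
(* The defect splits into that of the power and that of [P]; the latter is divisible by [z - l0]
   because [P] is 1 at [l0]. *)
have -> : 1 - P.[z] * (z / l0) ^+ k
    = P.[z] * (1 - (z / l0) ^+ k) - P3.[z] * (z - l0).
  by rewrite -P3E; move: P.[z] ((z / l0) ^+ k) => u v; ring.
apply: (le_trans (cabsB _ _)); rewrite !cabsM.
have h1 : cabs (z / l0 - 1) <= d / cabs l0.
  rewrite -(divff l00) -mulrBl cabsM cabsV ler_pM2r ?invr_gt0 //.
have h2 := cabs_exprB1 h1 kd; rewrite cabs_distC in h2.
have kd0 : 0 <= k%:R * d by rewrite mulr_ge0.
have : cabs P.[z] * cabs (1 - (z / l0) ^+ k) <= C4 * (k%:R * d).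
  have -> : C4 * (k%:R * d) = C1 * (expR 1 * (k%:R * (d / cabs l0))).
    by rewrite /C4; move: (k%:R) (expR 1) => u v; ring.
  by rewrite ler_pM ?cabs_ge0 // C1P.
have : cabs P3.[z] * cabs (z - l0) <= C3 * d by rewrite ler_pM ?cabs_ge0 // C3P.
have -> : k.+1%:R * d = k%:R * d + d by rewrite -natr1 mulrDl mul1r.
have := mulr_ge0 C10 d0; have := mulr_ge0 C30 kd0; have := mulr_ge0 C40 d0.
have := mulr_ge0 C10 kd0; have := mulr_ge0 C2s d0; have := mulr_ge0 C2s kd0.
move: (k%:R * d) (\sum_(l <- L) _) => u v; nra.
Qed.
End ComplexBounds.

(** * Eigenvalue counts from test polynomials *)

Section Sidestep.
Variables (R : realType) (La0 La1 : R) (N : set nat) (M : forall n, matrix_space R n).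
Variables (c p g : nat -> nat -> R[i]) (Lb : nat -> {fset R[i]}).
Variable s : nat -> R[i] -> {poly R[i]}.
Local Notation cabs := (@ComplexField.Normc.normc R).
Hypotheses (La0_gt0 : 0 < La0) (La0_lt_La1 : La0 < La1).
Hypothesis Mbounded : bounded_model La0 La1 N M.
Hypothesis expansions : forall r, (0 < r)%N -> exists K cr (D : R),
  [/\ (K n)%:R / ln (n%:R : R) @[n --> toinfty N] --> +oo,
      has_growth La1 cr, 0 <= D &
      forall n k, N n -> (1 <= k <= K n)%N ->
        cabs ((mean_trace M n k)%:C - \sum_(i < r) c i k / n%:R ^+ i)
        <= D * cabs (cr k) / n%:R ^+ r].
Hypothesis p_repr : forall i, poly_repr (p i) (Lb i) (s i).
Hypothesis Lb_real : forall i l, l \in Lb i -> complex.Im l = 0.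
Hypothesis g_growth : forall i, has_growth La0 (g i).
Hypothesis cE : forall i k, (0 < k)%N -> c i k = p i k + g i k.

Let La1_gt0 : 0 < La1 := lt_trans La0_gt0 La0_lt_La1.

Lemma logk_gt0 (A : R) n a : (0 < logk A n + a)%N.
Proof. by rewrite addn_gt0 /logk muln_gt0. Qed.

(** The two errors stay separate because they are beaten differently: the one from the [g i], of
    growth [La0], by the choice of [A], the remainder by the choice of [r]. *)
Lemma test_mean r P a (A e : R) : (0 < r)%N -> 0 < A -> 0 < e ->
  exists2 C : R, 0 <= C & \forall n \near toinfty N,
    let k := (logk A n + a)%N in
    cabs (cspec_mean (M n) (fun z => P.[z] * z ^+ k)
          - \sum_(i < r) shift_op P (p i) k / n%:R ^+ i)
    <= C * ((La0 + e) ^+ k + (La1 + e) ^+ k / n%:R ^+ r).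
Proof.
move=> r0 A0 e0; have [K [cr [D [Koo cr_growth D0 Dbound]]]] := expansions r0.
have [C1 C10 C1P] := has_growth_sum (size P) (ltW La1_gt0) e0
  (fun a => cabs_ge0 P`_a) cr_growth.
have /choice[Cg CgP] : forall i, exists C : R, 0 <= C /\
    \forall k \near \oo, cabs (shift_op P (g i) k) <= C * (La0 + e) ^+ k.
  move=> i; have [C C0 CP] := has_growth_shift_op P (ltW La0_gt0) e0 (g_growth i).
  by exists C.
have La0e : 0 < La0 + e by rewrite addr_gt0.
have La1e : 0 < La1 + e by rewrite addr_gt0.
pose CG := \sum_(i < r) Cg i.
have CG0 : 0 <= CG by apply: sumr_ge0 => i _; case: (CgP i).
exists (D * C1 + CG); first by rewrite addr_ge0 // mulr_ge0.
have koo := @logk_cvg R N A a A0.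
have allg : \forall k \near \oo, forall i : 'I_r,
    cabs (shift_op P (g i) k) <= Cg i * (La0 + e) ^+ k.
  by apply: filter_forall => i; case: (CgP i).
near=> n; set k := (logk A n + a)%N.
have n0 : (0 < n)%N by near: n; exact: toinfty_ge.
have Nn : N n by near: n; exact: toinfty_in.
(* The shift operator reads traces at exponents beyond [k], and these must be in range too. *)
have kK : (logk A n + (a + size P) <= K n)%N.
  by near: n; exact: logk_range (ltW A0) Koo.
rewrite addnA -/k in kK.
have k0 : (0 < k)%N by exact: logk_gt0.
pose Er k := (mean_trace M n k)%:C - \sum_(i < r) c i k / n%:R ^+ i.
have -> : cspec_mean (M n) (fun z => P.[z] * z ^+ k)
    - \sum_(i < r) shift_op P (p i) k / n%:R ^+ i
    = shift_op P Er k + \sum_(i < r) shift_op P (g i) k / n%:R ^+ i.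
  rewrite cspec_mean_poly //; apply/eqP; rewrite subr_eq -addrA -big_split /=.
  under [X in _ == _ + X]eq_bigr do rewrite -mulrDl -shift_opD -shift_opMr.
  rewrite -shift_op_sum -shift_opD; apply/eqP/eq_shift_op => j.
  rewrite /Er; under [X in _ = _ + X]eq_bigr do rewrite addrC -cE ?addn_gt0 ?k0 //.
  by rewrite subrK.
have x0 : 0 <= (La0 + e) ^+ k by rewrite exprn_ge0 // ltW.
have y0 : 0 <= (La1 + e) ^+ k / n%:R ^+ r.
  by rewrite mulr_ge0 ?invr_ge0 ?exprn_ge0 // ltW.
have hEr : cabs (shift_op P Er k) <= D * C1 * ((La1 + e) ^+ k / n%:R ^+ r).
  have C1k : \sum_(b < size P) cabs P`_b * cabs (cr (k + b)%N) <= C1 * (La1 + e) ^+ k.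
    by rewrite /k; near: n; exact: (koo _ C1P).
  have Erk b : (b < size P)%N ->
      cabs (Er (k + b)%N) <= D * cabs (cr (k + b)%N) / n%:R ^+ r.
    move=> bP; apply: Dbound => //; rewrite addn_gt0 k0 /=.
    by rewrite (leq_trans _ kK) // leq_add2l ltnW.
  apply: (@le_trans _ _ (D / n%:R ^+ r * (C1 * (La1 + e) ^+ k))); last first.
    rewrite le_eqVlt; apply/orP; left; apply/eqP.
    by move: ((La1 + e) ^+ k) (n%:R ^- r) => y w; ring.
  apply: (le_trans _ (ler_wpM2l _ C1k)); last first.
    by rewrite mulr_ge0 ?invr_ge0 ?exprn_ge0.
  rewrite mulr_sumr (le_trans (cabs_sum _ _ _)) //; apply: ler_sum => b _.
  rewrite cabsM mulrCA ler_wpM2l ?cabs_ge0 // mulrAC.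
  exact: Erk.
have hg : cabs (\sum_(i < r) shift_op P (g i) k / n%:R ^+ i) <= CG * (La0 + e) ^+ k.
  rewrite mulr_suml (le_trans (cabs_sum _ _ _)) //; apply: ler_sum => i _.
  rewrite cabs_divnX (le_trans _ (_ : cabs (shift_op P (g i) k) <= _)) //.
    rewrite ler_pdivrMr ?exprn_gt0 ?ltr0n // ler_peMr ?cabs_ge0 //.
    by rewrite exprn_ege1 // ler1n.
  have gk : forall i : 'I_r, cabs (shift_op P (g i) k) <= Cg i * (La0 + e) ^+ k.
    by rewrite /k; near: n; exact: (koo _ allg).
  exact: gk.
apply: (le_trans (cabsD _ _)); apply: (le_trans (lerD hEr hg)).
rewrite mulrDl lerD // ler_wpM2l ?mulr_ge0 //.
  by rewrite lerDr.
by rewrite lerDl.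
Unshelve. all: by end_near. Qed.

Lemma spectrumP n A z : N n -> A \in atoms (M n) ->
  eigenvalue (to_complex_mx A) z ->
  cabs z <= La0 \/ exists2 x, z = x%:C & `|x| <= La1.
Proof.
case: Mbounded => _ _ h Nn AM zA; have [] := h n Nn A AM z zA.
  by rewrite cdiskE /= subr0; left.
by case=> x; rewrite /= in_itv /= -ler_norml => xLa1 <-; right; exists x.
Qed.

Lemma spectrum_le n A z : N n -> A \in atoms (M n) ->
  eigenvalue (to_complex_mx A) z -> cabs z <= La1.
Proof.
move=> Nn AM zA; have [|[x -> ]] := spectrumP Nn AM zA; last by rewrite cabs_real.
by move/le_trans; apply; exact: ltW.
Qed.

Lemma shift_op_annihilate P (L : {fset R[i]}) i k : (0 < k)%N ->
  (Lb i `<=` L)%fset ->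
  (forall l, l \in L -> forall k, shift_op P (expterm (s i l) l) k = 0) ->
  shift_op P (p i) k = 0.
Proof.
move=> k0 LiL PL.
rewrite (@eq_shift_op _ _ _ (fun k => \sum_(l <- L) expterm (s i l) l k)); last first.
  by move=> a; apply: (poly_repr_incl (p_repr i) LiL); rewrite addn_gt0 k0.
by rewrite shift_op_sum big_seq big1 // => l lL; rewrite PL.
Qed.

Lemma size_bound (r : nat) (L : {fset R[i]}) : exists m : nat,
  forall i l, (i < r)%N -> l \in L -> (size (s i l) <= m)%N.
Proof.
exists (\max_(i < r) \max_(l <- L) size (s i l)) => i l ir lL.
apply: (leq_trans _ (leq_bigmax (Ordinal ir))) => /=.
by rewrite (big_rem l lL) /= leq_maxl.
Qed.

(** A Markov inequality: with [d = n^-th], each counted eigenvalue is real and contributes at least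
    [d^dg (La0 + e)^k] to the real part of the mean of [Q(z) z^k]; each other one contributes at
    least [- CQ (La0 + e / 2)^k]. The bound [r0] must not depend on [L], since [L] has to contain
    the bases of the first [r] coefficients. *)
Lemma Eout_obnd (e : R) (t : nat) : 0 < e -> exists r0 : nat,
  forall r, (r0 <= r)%N -> forall L : {fset R[i]},
  (forall i, (i < r)%N -> (Lb i `<=` L)%fset) ->
  (forall l, l \in L -> complex.Im l = 0) ->
  exists2 th0 : R, 0 < th0 & forall th, 0 < th < th0 ->
    obnd N (fun n => Eout (M n)
      (cdisk (La0 + e) 0 `|` cnbhd (n%:R `^ (- th)) [set` L])) (- t%:R).
Proof.
move=> e0; have e2 : 0 < e / 2 by rewrite divr_gt0.
have La0e : 0 < La0 + e by rewrite addr_gt0.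
have La0e2 : 0 < La0 + e / 2 by rewrite addr_gt0.
have La1e2 : 0 < La1 + e / 2 by rewrite addr_gt0.
pose rho := (La0 + e / 2) / (La0 + e).
have rho0 : 0 < rho by rewrite divr_gt0.
have lnrho : ln rho < 0.
  by apply: ln_lt0; rewrite rho0 /= ltr_pdivrMr // mul1r; lra.
(* Makes [rho ^+ k] of order [n^-(t + 2)]: one power of [n] pays for the number of eigenvalues, the
   other for the division by [d^dg]. *)
pose A := (t%:R + 2) / (2 * - ln rho).
have A0 : 0 < A by rewrite divr_gt0 // ?mulr_gt0 ?oppr_gt0 // ltr_wpDl.
have AE : 2 * A * ln rho = - (t%:R + 2).
  by rewrite /A; field; rewrite lt_eqF.
pose B := (La1 + e / 2) / (La0 + e).
have B0 : 0 < B by rewrite divr_gt0.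
(* [B ^+ k] is of order [n^(2 A ln B)]; this order brings [B ^+ k / n^r] down to [n^-(t + 1)]. *)
exists (Num.truncn (2 * A * ln B + t%:R + 1)).+1 => r rr0 L LbL Lreal.
have r0 : (0 < r)%N by apply: leq_trans rr0.
have rB : 2 * A * ln B - r%:R <= - (t%:R + 1).
  have : 2 * A * ln B + t%:R + 1 <= r%:R; last by lra.
  by rewrite (le_trans (ltW (truncnS_gt _))) // ler_nat.
have [m szm] := size_bound r L.
pose Q := \prod_(l <- L) ('X - l%:P) ^+ (2 * m).
(* The degree of [Q], which is at least [d^dg] at real points at distance at least [d] from [L]. The
   next choice keeps the loss [d^-dg] below [n]. *)
pose dg := (2 * m * size L)%N.
exists (dg%:R + 1)^-1; first by rewrite invr_gt0 ltr_wpDl.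
move=> th /andP[th0 thdg].
have {}thdg : th * dg%:R <= 1.
  move: thdg; rewrite -[X in _ < X]mul1r ltr_pdivlMr ?ltr_wpDl //; nra.
have [C C0 CP] := test_mean Q 0 r0 A0 e2.
have [CQ CQ0 CQP] := poly_disk_cabs Q La0.
pose rhs n : R := C * (rho ^+ (logk A n + 0) + B ^+ (logk A n + 0) * n%:R ^- r)
  + CQ * (rho ^+ (logk A n + 0) * n%:R).
apply: (@obnd_le _ _ (fun n => n%:R `^ (th * dg%:R) * rhs n)); last first.
  have -> : - t%:R = 1 + - (t%:R + 1) :> R by ring.
  apply: obndM.
    by apply: (obndW thdg); exact: obnd_powR.
  have orho := @obnd_explogk R N A rho 0 (ltW A0) rho0.
  have oB := @obnd_explogk R N A B 0 (ltW A0) B0.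
  apply: obndD; apply: obndMl.
    apply: obndD; first by apply: obndW orho; rewrite AE; lra.
    by apply: obndW (obndM oB (obnd_natXV _ _ r)); lra.
  by apply: obndW (obndM orho (obnd_id _ _)); rewrite AE; lra.
near=> n.
have n0 : (0 < n)%N by near: n; exact: toinfty_ge.
have Nn : N n by near: n; exact: toinfty_in.
rewrite ger0_norm ?Ein_ge0 //.
set d := n%:R `^ (- th).
have d0 : 0 < d by rewrite powR_gt0 // ltr0n.
set k := (logk A n + 0)%N.
have k0 : (0 < k)%N by exact: logk_gt0.
have kev : ~~ odd k by rewrite /k addn0 /logk oddM.
have dE : n%:R `^ (th * dg%:R) = (d ^+ dg)^-1.
  by rewrite powRrM powR_mulrn ?powR_ge0 // /d powRN exprVn invrK.
have rhs0 : 0 <= rhs n.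
  by rewrite addr_ge0 // mulr_ge0 ?addr_ge0 ?mulr_ge0 ?invr_ge0 ?exprn_ge0 // ltW.
have rhsE : (La0 + e) ^+ k * rhs n
  = C * ((La0 + e / 2) ^+ k + (La1 + e / 2) ^+ k / n%:R ^+ r)
    + CQ * (La0 + e / 2) ^+ k * n%:R.
  rewrite /rhs -/k /rho /B !expr_div_n.
  have : (La0 + e) ^+ k != 0 by rewrite expf_neq0 // gt_eqF.
  move: ((La0 + e) ^+ k) ((La0 + e / 2) ^+ k) ((La1 + e / 2) ^+ k) (n%:R ^- r).
  by move=> x y z w x0; field.
rewrite ger0_norm ?mulr_ge0 ?powR_ge0 // dE.
rewrite ler_pdivlMl ?exprn_gt0 // -(ler_pM2l (exprn_gt0 k La0e)) rhsE.
rewrite mulrA mulrC mulrA.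
set S := _ `|` _.
have -> : Eout (M n) S * (La0 + e) ^+ k * d ^+ dg
    = spec_mean (M n) (fun z => (d ^+ dg * (La0 + e) ^+ k) * (`[< (~` S) z >])%:R).
  rewrite spec_meanZ /Eout Ein_spec_mean.
  by move: ((La0 + e) ^+ k) (d ^+ dg) (spec_mean _ _) => x y z; ring.
have Q0 i : (i < r)%N -> shift_op Q (p i) k = 0.
  move=> ir; apply: (shift_op_annihilate k0 (LbL i ir)) => l lL k'.
  by apply: shift_op_prod_eq0 => //; rewrite (leq_trans (szm i l ir lL)) // leq_pmull.
have mean_le : complex.Re (cspec_mean (M n) (fun z => Q.[z] * z ^+ k))
    <= C * ((La0 + e / 2) ^+ k + (La1 + e / 2) ^+ k / n%:R ^+ r).
  apply: (le_trans (ler_norm _)); apply: (le_trans (Re_le_cabs _)).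
  have CPn : cabs (cspec_mean (M n) (fun z => Q.[z] * z ^+ k)
      - \sum_(i < r) shift_op Q (p i) k / n%:R ^+ i)
      <= C * ((La0 + e / 2) ^+ k + (La1 + e / 2) ^+ k / n%:R ^+ r).
    by rewrite /k; near: n; exact: CP.
  by rewrite big1 ?subr0 // in CPn => i _; rewrite Q0 ?mul0r.
(* The added constant makes the test function nonnegative on the disk, where the real part of
   [Q(z) z^k] has no definite sign. *)
apply: (@le_trans _ _ (spec_mean (M n)
    (fun z => complex.Re (Q.[z] * z ^+ k) + CQ * (La0 + e / 2) ^+ k))); last first.
  by rewrite spec_meanD spec_mean_cst -Re_cspec_mean lerD2r.
apply: le_spec_mean => A' AM z zA.
have [zLa0|[x zx _]] := spectrumP Nn AM zA.
  have -> : `[< (~` S) z >] = false.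
    apply/asboolPn => /=; apply; left; rewrite cdiskE /= subr0 (le_trans zLa0) //.
    by rewrite lerDl ltW.
  have zQ : cabs (Q.[z] * z ^+ k) <= CQ * (La0 + e / 2) ^+ k.
    rewrite cabsM cabsX ler_pM ?cabs_ge0 ?exprn_ge0 ?CQP //; first exact: cabs_ge0.
    by rewrite lerXn2r ?nnegrE ?cabs_ge0 ?(ltW La0e2) // (le_trans zLa0) // lerDl ltW.
  have := Re_le_cabs (Q.[z] * z ^+ k); rewrite ler_norml => /andP[h _].
  by rewrite mulr0 -lerBlDr sub0r (le_trans _ h) // lerN2.
have [v0 vlow] := even_prod_lower_bound m x Lreal kev (ltW d0) (ltW La0e).
rewrite zx -/Q in v0 vlow *.
have CQk : 0 <= CQ * (La0 + e / 2) ^+ k by rewrite mulr_ge0 ?exprn_ge0 // ltW.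
have [/= xS|_] := asboolP ((~` S) x%:C); last by rewrite mulr0 addr_ge0.
rewrite mulr1 (le_trans (vlow _ _)) ?lerDl //.
  move=> l lL; rewrite leNgt; apply/negP => xl; apply: xS; right.
  by exists l => //; rewrite cdiskE /= ltW.
rewrite leNgt; apply/negP => xl; apply: xS; left.
by rewrite cdiskE /mkset subr0 cabs_real ltW.
Unshelve. all: by end_near. Qed.

Lemma shift_op_peak (L : {fset R[i]}) l0 m i k : (0 < k)%N -> l0 \in L ->
  (Lb i `<=` L)%fset -> (forall l, l \in L -> (size (s i l) <= m)%N) ->
  shift_op (peak_poly L l0 m) (p i) k
  = expterm (shift_coef (peak_poly L l0 m) l0 (s i l0)) l0 k.
Proof.
move=> k0 l0L LiL szm; rewrite -shift_op_expterm.
rewrite (@eq_shift_op _ _ _ (fun k => \sum_(l <- L) expterm (s i l) l k)); last first.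
  by move=> a; apply: (poly_repr_incl (p_repr i) LiL); rewrite addn_gt0 k0.
rewrite shift_op_sum (big_fsetD1 l0) //= big1_fset ?addr0 // => l.
rewrite in_fsetD1 => /andP[ll0 lL] _.
have [P ->] := peak_poly_dvd m lL ll0.
by apply: shift_op_expterm_XsubCX; exact: szm.
Qed.

(** One term for each of four regions: near [l0] the test function is close to 1; on the disk its
    power decays; near the rest of [L] the zeros of order [m] act; elsewhere it may be large, but
    [Eout] is small. *)
Lemma peak_Ein n (L : {fset R[i]}) l0 m (C d e : R) k : N n -> 0 <= C -> 0 <= d ->
  0 < e -> 0 < cabs l0 -> k%:R * (d / cabs l0) <= 1 ->
  (forall z, cabs z <= La1 -> let P := peak_poly L l0 m in
    [/\ cabs P.[z] <= C,
        (forall l, l \in L -> l != l0 -> cabs P.[z] <= C * cabs (z - l) ^+ m) &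
        forall k (d : R), cabs (z - l0) <= d -> k%:R * (d / cabs l0) <= 1 ->
          cabs (1 - P.[z] * (z / l0) ^+ k) <= C * (k.+1%:R * d)]) ->
  cabs ((Ein (M n) (cdisk d l0))%:C
        - cspec_mean (M n) (fun z => (peak_poly L l0 m).[z] * (z / l0) ^+ k))
  <= C * (k.+1%:R * d) * Ein (M n) (cdisk d l0)
     + (C * ((La0 + e) / cabs l0) ^+ k * n%:R
        + C * (d ^+ m * ((La1 + e) / cabs l0) ^+ k) * n%:R
        + C * ((La1 + e) / cabs l0) ^+ k
          * Eout (M n) (cdisk (La0 + e) 0 `|` cnbhd d [set` L])).
Proof.
move=> Nn C0 d0 e0 al0 kd Cbound; set P := peak_poly L l0 m.
set S := _ `|` _; set D := cdisk d l0; set rho := _ / _; set B := (La1 + e) / _.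
have rho0 : 0 <= rho by rewrite divr_ge0 ?addr_ge0 // ltW.
have B0 : 0 <= B by rewrite divr_ge0 ?addr_ge0 // ltW.
rewrite /Eout !Ein_spec_mean -cspec_mean_real -cspec_meanB -!spec_meanZ.
rewrite -!(spec_mean_cst (M n)) -!spec_meanD.
apply: (le_trans (cabs_cspec_mean _ _)); apply: le_spec_mean => A AM z zA.
have zLa1 := spectrum_le Nn AM zA.
have [PC PL Pl0] := Cbound z zLa1.
have t1 : 0 <= C * rho ^+ k by rewrite mulr_ge0 ?exprn_ge0.
have t2 : 0 <= C * (d ^+ m * B ^+ k) by rewrite !mulr_ge0 ?exprn_ge0.
have t3 : 0 <= C * B ^+ k by rewrite mulr_ge0 ?exprn_ge0.
have zB : cabs (z / l0) ^+ k <= B ^+ k.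
  rewrite lerXn2r ?nnegrE ?cabs_ge0 // cabsM cabsV ler_pM2r ?invr_gt0 //.
  by rewrite (le_trans zLa1) // lerDl ltW.
have [Dz|nDz] := asboolP (D z).
  rewrite mulr1 (le_trans (Pl0 k d _ kd)) //; first by rewrite /D cdiskE in Dz.
  by rewrite lerDl !addr_ge0 // mulr_ge0.
rewrite mulr0 !add0r cabsN cabsM cabsX.
have [nSz|] := asboolP ((~` S) z).
  rewrite mulr1; apply: (@le_trans _ _ (C * B ^+ k)).
    by rewrite ler_pM ?cabs_ge0 ?exprn_ge0 ?cabs_ge0.
  by rewrite lerDr addr_ge0.
rewrite mulr0 addr0 => /contrapT[|[l /= lL]].
  rewrite cdiskE /= subr0 => zLa0.
  apply: (@le_trans _ _ (C * rho ^+ k)); last by rewrite lerDl.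
  rewrite ler_pM ?cabs_ge0 ?exprn_ge0 ?cabs_ge0 // lerXn2r ?nnegrE ?cabs_ge0 //.
  by rewrite cabsM cabsV ler_pM2r ?invr_gt0.
rewrite cdiskE /= => zl.
apply: (@le_trans _ _ (C * (d ^+ m * B ^+ k))); last by rewrite lerDr.
have ll0 : l != l0.
  by apply/negP => /eqP ll0; apply: nDz; rewrite /D cdiskE /= -ll0.
rewrite mulrA ler_pM ?cabs_ge0 ?exprn_ge0 ?cabs_ge0 // (le_trans (PL l lL ll0)) //.
by rewrite ler_wpM2l // lerXn2r ?nnegrE ?cabs_ge0.
Qed.

(** After division by [l0 ^+ k] only polynomials in [k] remain: coefficient [j] gives the main term,
    and the later ones are smaller by a power of [n], which outweighs their growth in [k]. *)
Lemma peak_trace r (L : {fset R[i]}) l0 m j k n (E : R) : (0 < k)%N -> l0 \in L ->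
  0 < cabs l0 -> (j < r)%N ->
  (forall i, (i < r)%N -> (Lb i `<=` L)%fset) ->
  (forall i l, (i < r)%N -> l \in L -> (size (s i l) <= m)%N) ->
  (forall i k, (i < j)%N -> (0 < k)%N -> p i k = 0) ->
  let P := peak_poly L l0 m in
  cabs (cspec_mean (M n) (fun z => P.[z] * z ^+ k)
        - \sum_(i < r) shift_op P (p i) k / n%:R ^+ i) <= E ->
  cabs (cspec_mean (M n) (fun z => P.[z] * (z / l0) ^+ k)
        - (shift_coef P l0 (s j l0)).[k%:R] / n%:R ^+ j)
  <= E / cabs l0 ^+ k + \sum_(i <- index_enum 'I_r | (j < i)%N)
       cabs (shift_coef P l0 (s i l0)).[k%:R] * n%:R ^- i.
Proof.
move=> k0 l0L al0 jr LbL szm pj0 P PE.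
have l0k : l0 ^+ k != 0 by rewrite expf_neq0 // -cabs_gt0.
have -> : cspec_mean (M n) (fun z => P.[z] * (z / l0) ^+ k)
    = (l0 ^+ k)^-1 * cspec_mean (M n) (fun z => P.[z] * z ^+ k).
  rewrite -cspec_meanZ; congr cspec_mean; apply/funext => z.
  by rewrite expr_div_n mulrA mulrC.
have sumE : \sum_(i < r) shift_op P (p i) k / n%:R ^+ i
    = l0 ^+ k * ((shift_coef P l0 (s j l0)).[k%:R] / n%:R ^+ j
      + \sum_(i < r | (j < i)%N) (shift_coef P l0 (s i l0)).[k%:R] / n%:R ^+ i).
  have sE (i : 'I_r) : shift_op P (p i) k / n%:R ^+ i
      = l0 ^+ k * ((shift_coef P l0 (s i l0)).[k%:R] / n%:R ^+ i).
    rewrite shift_op_peak //; [|exact: LbL|by move=> l; exact: szm].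
    by rewrite /expterm mulrAC mulrC.
  rewrite (bigID (fun i : 'I_r => (j < i)%N)) /= addrC mulrDr; congr (_ + _); last first.
    by rewrite mulr_sumr; apply: eq_bigr => i _; rewrite sE.
  rewrite (bigD1 (Ordinal jr)) /= ?ltnn // (sE (Ordinal jr)) /=.
  rewrite big1 ?addr0 // => i /andP[ij].
  rewrite -val_eqE /= => nij; have {}ij : (i < j)%N by rewrite ltn_neqAle nij leqNgt.
  rewrite (@eq_shift_op _ _ _ (fun=> 0)) => [|a]; last by rewrite pj0 // addn_gt0 k0.
  by rewrite /shift_op big1 ?mul0r // => a _; rewrite mulr0.
set F := cspec_mean _ _ in PE *; set u := _ / n%:R ^+ j in sumE *.
set v := \sum_(i < r | (j < i)%N) _ in sumE.
have -> : (l0 ^+ k)^-1 * F - u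
    = (l0 ^+ k)^-1 * (F - \sum_(i < r) shift_op P (p i) k / n%:R ^+ i) + v.
  rewrite [X in F - X]sumE; clear sumE PE.
  by move: (l0 ^+ k) l0k F u v => y y0 F' u' v'; field.
apply: (le_trans (cabsD _ _)); apply: lerD.
  rewrite cabsM cabsV cabsX mulrC ler_pM2r // invr_gt0 exprn_gt0 //.
apply: (le_trans (cabs_sum _ _ _)); apply: ler_sum => i _.
by rewrite cabs_divnX.
Qed.

Lemma bases_union (r : nat) : exists U : {fset R[i]},
  (forall i, (i < r)%N -> (Lb i `<=` U)%fset) /\
  (forall l, l \in U -> exists i, l \in Lb i).
Proof.
elim: r => [|r [U [LU UL]]]; first by exists fset0; split=> // l; rewrite in_fset0.
exists (U `|` Lb r)%fset; split=> [i|l].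
  rewrite ltnS leq_eqVlt => /predU1P[->|ir]; first exact: fsubsetUr.
  by apply: fsubset_trans (LU i ir) (fsubsetUl _ _).
by case/fsetUP => [/UL//|lr]; exists r.
Qed.

(* [A] makes the contribution of the disk negligible, [t] then that of the
   eigenvalues away from [L], and [m], which may depend on [th], that of the
   eigenvalues near the elements of [L] other than [l0]. *)
Lemma Ein_peak l0 j : complex.Im l0 = 0 -> La0 < cabs l0 ->
  (forall i k, (i < j)%N -> (0 < k)%N -> p i k = 0) ->
  exists A th0 : R, [/\ 0 < A, 0 < th0 & forall th, 0 < th < th0 ->
    exists P (kap : R), [/\ P.[l0] = 1, kap < 0 & forall a,
      obnd N (fun n => cabs ((n%:R ^+ j * Ein (M n) (cdisk (n%:R `^ (- th)) l0))%:C
        - (shift_coef P l0 (s j l0)).[(logk A n + a)%:R])) kap]].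
Proof.
move=> l0real l0La0 pj0; have al0 : 0 < cabs l0 by apply: lt_trans l0La0.
pose e := (cabs l0 - La0) / 2.
have e0 : 0 < e by rewrite divr_gt0 // subr_gt0.
have La0e : 0 < La0 + e by rewrite addr_gt0.
have La1e : 0 < La1 + e by rewrite addr_gt0.
pose rho := (La0 + e) / cabs l0.
have rho0 : 0 < rho by rewrite divr_gt0.
have lnrho : ln rho < 0.
  by apply: ln_lt0; rewrite rho0 /= ltr_pdivrMr // mul1r /e; lra.
pose A := (j%:R + 2) / (2 * - ln rho).
have A0 : 0 < A by rewrite divr_gt0 // ?mulr_gt0 ?oppr_gt0 // ltr_wpDl.
have AE : 2 * A * ln rho = - (j%:R + 2) by rewrite /A; field; rewrite lt_eqF.
pose B := (La1 + e) / cabs l0.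
have B0 : 0 < B by rewrite divr_gt0.
pose b := 2 * A * ln B.
(* [B ^+ k] is of order [n^b], so [Eout = O(n^-t)] leaves at most [n^-(j + 1)] from the far
   eigenvalues. *)
pose t := (Num.truncn (b + j%:R + 1)).+1.
have bt : b - t%:R <= - (j%:R + 1).
  have : b + j%:R + 1 <= t%:R by rewrite ltW // truncnS_gt.
  by lra.
have [r0 r0P] := Eout_obnd t e0.
pose r := maxn r0 (maxn j.+1 t).
have r0r : (r0 <= r)%N by rewrite leq_maxl.
have jr : (j < r)%N by rewrite /r !leq_max leqnn orbT.
have tr : (t <= r)%N by rewrite /r !leq_max leqnn !orbT.
have [U [LU UL]] := bases_union r.
(* [l0] is not assumed to be a base of one of the first [r] coefficients, so it is added. *)
pose L := (l0 |` U)%fset.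
have LL i : (i < r)%N -> (Lb i `<=` L)%fset.
  by move=> ir; apply: fsubset_trans (LU i ir) (fsubsetUr _ _).
have Lreal l : l \in L -> complex.Im l = 0.
  by case/fset1UP => [->//|lU]; have [i li] := UL l lU; exact: Lb_real li.
have l0L : l0 \in L by rewrite fset1U1.
have [th0 th00 th0P] := r0P r r0r L LL Lreal.
exists A, th0; split=> // th thth0; have th_gt0 : 0 < th by case/andP: thth0.
have [m0 szm0] := size_bound r L.
(* [m0] suffices for annihilation; the other bound makes [d^m B^k n] at most of order
   [n^-(j + 1)]. *)
pose m := maxn m0 (Num.truncn ((b + j%:R + 2) / th)).+1.
have szm i l : (i < r)%N -> l \in L -> (size (s i l) <= m)%N.
  by move=> ir lL; rewrite leq_max szm0.
have mth : b + j%:R + 2 <= m%:R * th.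
  rewrite -ler_pdivrMr // (le_trans (ltW (truncnS_gt _))) // ler_nat.
  by rewrite leq_max leqnn orbT.
pose P := peak_poly L l0 m.
(* The scaled errors are [O(n^-(1/2))], half a power of [n] being spent on polynomials in [k]; and
   [eta * X] is [O(n^-(th/4))], from [n^-(th/2)] for [eta] and [n^(th/4)] for [X]. *)
pose kap := - Num.min (1 / 2) (th / 4).
have kap_half : - (1 / 2) <= kap by rewrite lerN2 ge_min lexx.
have kap_th : - (th / 4) <= kap by rewrite lerN2 ge_min lexx orbT.
exists P, kap; split; first exact: peak_poly1.
  by rewrite oppr_lt0 lt_min !divr_gt0.
move=> a; have r_gt0 : (0 < r)%N by apply: leq_ltn_trans jr.
have l00 : l0 != 0 by rewrite -cabs_gt0.
have [C C0 CP] := peak_poly_bound L m La1 l00.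
have [Ct Ct0 CtP] := test_mean P a r_gt0 A0 e0.
pose k n := (logk A n + a)%N.
pose d n : R := n%:R `^ (- th).
pose q i := shift_coef P l0 (s i l0).
pose E n := Ein (M n) (cdisk (d n) l0).
pose out n := Eout (M n) (cdisk (La0 + e) 0 `|` cnbhd (d n) [set` L]).
pose eta n := C * ((k n).+1%:R * d n).
pose err n := (C * rho ^+ k n * n%:R + C * (d n ^+ m * B ^+ k n) * n%:R
    + C * B ^+ k n * out n)
  + (Ct * ((La0 + e) ^+ k n + (La1 + e) ^+ k n / n%:R ^+ r) / cabs l0 ^+ k n
     + \sum_(i <- index_enum 'I_r | (j < i)%N) cabs (q i).[(k n)%:R] * n%:R ^- i).
have od : obnd N d (- th) by exact: obnd_powR.
have ok : obnd N (fun n => (k n).+1%:R) (th / 2).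
  have th2 : 0 < th / 2 by rewrite divr_gt0.
  have := @obnd_logk R N A a.+1 _ (ltW A0) th2.
  by apply: obnd_le; near=> n; rewrite /k addnS.
have okd : obnd N (fun n => (k n).+1%:R * d n) (- (th / 2)).
  by apply: obndW (obndM ok od); lra.
have eta_obnd : obnd N eta (- (th / 2)) by exact: obndMl.
have orho := @obnd_explogk R N A rho a (ltW A0) rho0; rewrite AE in orho.
have oB := @obnd_explogk R N A B a (ltW A0) B0; rewrite -/b in oB.
have err_obnd : obnd N err (- (j%:R + 1 / 2)).
  apply: obndD; first apply: obndD; first apply: obndD.
  - by apply: obndW (obndM (obndMl C orho) (obnd_id _ _)); lra.
  - apply: obndW (obndM (obndMl C (obndM (obndX m od) oB)) (obnd_id _ _)).
    by rewrite mulrN; lra.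
  - by apply: obndW (obndM (obndMl C oB) (th0P th thth0)); lra.
  apply: obndD.
    apply: (@obnd_le _ _ (fun n => Ct * (rho ^+ k n + B ^+ k n * n%:R ^- r))).
      near=> n; rewrite /rho /B !expr_div_n.
      move: ((La0 + e) ^+ k n) ((La1 + e) ^+ k n) (cabs l0 ^+ k n) (n%:R ^- r).
      by move=> x y z w; rewrite -mulrA mulrDl mulrAC.
    apply: obndMl; apply: obndD; first by apply: obndW orho; lra.
    apply: obndW (obndM oB (obnd_natXV _ _ r)).
    by move: tr; rewrite -(ler_nat R); lra.
  under eq_fun do rewrite big_mkcond.
  apply: obnd_sum => i _; have [ji|_] := ltnP j i; last first.
    by exists 0; near=> n; rewrite normr0 mul0r.
  apply: (@obndW _ _ (1 / 2 - i%:R)).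
    by move: ji; rewrite -(ler_nat R) -natr1; lra.
  apply: obndM; last exact: obnd_natXV.
  by apply: obnd_poly_logk; [exact: ltW|exact: divr_gt0].
have main : \forall n \near toinfty N,
    cabs ((E n)%:C - (q j).[(k n)%:R] / n%:R ^+ j) <= eta n * E n + err n.
  near=> n.
  have n0 : (0 < n)%N by near: n; exact: toinfty_ge.
  have Nn : N n by near: n; exact: toinfty_in.
  have kn0 : (0 < k n)%N by exact: logk_gt0.
  have kd : (k n)%:R * (d n / cabs l0) <= 1.
    have : `|(cabs l0)^-1 * ((k n).+1%:R * d n)| <= 1.
      near: n; apply: obnd_small => //; last by apply: obndMl; exact: okd.
      by rewrite oppr_lt0 divr_gt0.
    apply: le_trans; rewrite ger0_norm ?mulr_ge0 ?invr_ge0 ?cabs_ge0 ?powR_ge0 //.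
    rewrite mulrA mulrC ler_wpM2l ?invr_ge0 ?cabs_ge0 // ler_wpM2r ?powR_ge0 //.
    by rewrite ler_nat.
  have h1 := peak_Ein Nn C0 (powR_ge0 _ _) e0 al0 kd CP.
  have CtPn : cabs (cspec_mean (M n) (fun z => P.[z] * z ^+ k n)
      - \sum_(i < r) shift_op P (p i) (k n) / n%:R ^+ i)
      <= Ct * ((La0 + e) ^+ k n + (La1 + e) ^+ k n / n%:R ^+ r).
    by near: n; exact: CtP.
  have h2 := peak_trace kn0 l0L al0 jr LL szm pj0 CtPn.
  set F := cspec_mean _ _ in h1 h2.
  have -> : (E n)%:C - (q j).[(k n)%:R] / n%:R ^+ j
     = ((E n)%:C - F) + (F - (q j).[(k n)%:R] / n%:R ^+ j) by rewrite addrA subrK.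
  apply: (le_trans (cabsD _ _)); apply: (le_trans (lerD h1 h2)).
  by rewrite -addrA.
pose X n := n%:R ^+ j * E n.
pose err' n := n%:R ^+ j * err n.
have X0 n : 0 <= X n by rewrite mulr_ge0 ?exprn_ge0 ?Ein_ge0.
have err'_obnd : obnd N err' (- (1 / 2)).
  by apply: obndW (obndM (obnd_natX _ _ j) err_obnd); lra.
have mainX : \forall n \near toinfty N,
    cabs ((X n)%:C - (q j).[(k n)%:R]) <= eta n * X n + err' n.
  near=> n; have n0 : (0 < n)%N by near: n; exact: toinfty_ge.
  have nj0 : (n%:R : R[i]) ^+ j != 0 by rewrite expf_neq0 // pnatr_eq0 -lt0n.
  have -> : (X n)%:C - (q j).[(k n)%:R]
      = n%:R ^+ j * ((E n)%:C - (q j).[(k n)%:R] / n%:R ^+ j).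
    rewrite mulrBr mulrCA divff // mulr1; congr (_ - _).
    by rewrite /X rmorphM rmorphXn rmorph_nat.
  rewrite cabsM cabsX cabs_nat /X /err' mulrCA -mulrDr ler_wpM2l ?exprn_ge0 //.
  by near: n; exact: main.
(* Once [eta <= 1 / 2], the term [eta * X] is absorbed by half of [X], which bounds [X] by a
   polynomial in [k] plus a small error. *)
have X_obnd : obnd N X (th / 4).
  apply: (@obnd_le _ _ (fun n => 2 * (cabs (q j).[(k n)%:R] + `|err' n|))).
    near=> n; rewrite ger0_norm // ger0_norm ?mulr_ge0 ?addr_ge0 ?cabs_ge0 //.
    have eta12 : `|eta n| <= 1 / 2.
      near: n; apply: obnd_small eta_obnd; last exact: divr_gt0.
      by rewrite oppr_lt0 divr_gt0.
    have etaX : eta n * X n <= 1 / 2 * X n.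
      by rewrite ler_wpM2r // (le_trans (ler_norm _) eta12).
    have Xq : cabs ((X n)%:C - (q j).[(k n)%:R]) <= eta n * X n + err' n.
      by near: n; exact: mainX.
    have := cabsD ((X n)%:C - (q j).[(k n)%:R]) (q j).[(k n)%:R].
    rewrite subrK cabs_real (ger0_norm (X0 n)); have := ler_norm (err' n).
    move: Xq etaX; move: (cabs _) (cabs _) (eta n * _) => u v w; lra.
  apply: obndMl; apply: obndD.
    by apply: obnd_poly_logk; [exact: ltW|exact: divr_gt0].
  case: err'_obnd => D err'D; apply: (@obndW _ _ (- (1 / 2))).
    by apply: (@le_trans _ _ 0); rewrite ?oppr_le0 ?divr_ge0 // ltW.
  by exists D; near=> n; rewrite normr_id; near: n.
apply: (@obnd_le _ _ (fun n => eta n * X n + err' n)).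
  near=> n; rewrite ger0_norm ?cabs_ge0 // (le_trans _ (ler_norm _)) //.
  by near: n; exact: mainX.
apply: obndD; last by apply: obndW err'_obnd.
by apply: obndW (obndM eta_obnd X_obnd); lra.
Unshelve. all: by end_near. Qed.
Lemma Ein_limit l0 j : complex.Im l0 = 0 -> La0 < cabs l0 ->
  (forall i k, (i < j)%N -> (0 < k)%N -> p i k = 0) ->
  exists x : R, [/\ s j l0 = (x%:C)%:P, 0 <= x &
    \forall th \near (0 : R)^'+,
      n%:R ^+ j * Ein (M n) (cdisk (n%:R `^ (- th)) l0) @[n --> toinfty N] --> x].
Proof.
move=> l0real l0La0 pj0.
have PF : ProperFilter (toinfty N) by apply: toinfty_proper; case: Mbounded.
have [A [th0 [A0 th00 peak]]] := Ein_peak l0real l0La0 pj0.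
pose X th n := n%:R ^+ j * Ein (M n) (cdisk (n%:R `^ (- th)) l0).
pose x := complex.Re (s j l0)`_0.
(* [P] and [q] depend on [th], but the constant term of [s j l0] does not, so a single limit serves
   all small [th]. *)
have core th : 0 < th < th0 -> s j l0 = ((s j l0)`_0)%:P /\
    forall e : R, 0 < e -> \forall n \near toinfty N,
      cabs ((X th n)%:C - (s j l0)`_0) <= e.
  move=> /peak[P [kap [P1 kap0 Pobnd]]]; pose q := shift_coef P l0 (s j l0).
  have close a (e : R) : 0 < e -> \forall n \near toinfty N,
      cabs ((X th n)%:C - q.[(logk A n + a)%:R]) <= e.
    move=> e0; apply: filterS (obnd_small kap0 e0 (Pobnd a)) => n.
    by rewrite ger0_norm ?cabs_ge0.
  have qconst : (size q <= 1)%N.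
    apply: size_diff_poly_eq0.
    apply: (poly_nat_small_eq0 (@logk_cvg R N A 0 A0)) => e e0.
    have e3 : 0 < e / 3 by rewrite divr_gt0.
    near=> n; rewrite hornerD hornerN horner_comp hornerD hornerX hornerC natr1 -addnS.
    have -> : q.[(logk A n + 1)%:R] - q.[(logk A n + 0)%:R]
      = ((X th n)%:C - q.[(logk A n + 0)%:R]) - ((X th n)%:C - q.[(logk A n + 1)%:R]).
      by move: (X th n)%:C q.[_] q.[_] => u v w; ring.
    apply: (le_lt_trans (cabsB _ _)).
    apply: (@le_lt_trans _ _ (e / 3 + e / 3)); last by lra.
    by apply: lerD; near: n; exact: close.
  have [sE qE] := shift_coef_const P1 qconst; split=> // e e0.
  by apply: filterS (close 0%N e e0) => n; rewrite /q qE hornerC.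
have th02 : 0 < th0 / 2 < th0.
  by rewrite divr_gt0 //= ltr_pdivrMr // mulr2n mulrDr mulr1 ltrDl.
have [sE closeX] := core _ th02.
(* The approximants [X] are nonnegative reals, which forces the limit to be one. The imaginary part
   is read off as a real part after multiplication by ['i]. *)
have ReIm e : 0 < e -> `|complex.Im (s j l0)`_0| <= e /\ - e <= x.
  move=> e0; have [n] := filter_ex (closeX e e0).
  have Xn0 : 0 <= X (th0 / 2) n by rewrite mulr_ge0 ?exprn_ge0 ?Ein_ge0.
  rewrite /x; move: (X _ n) Xn0 ((s j l0)`_0) => u u0 [v w] h; split.
    apply: le_trans h; have := Re_le_cabs ((u%:C - (v +i* w)) * 'i).
    by rewrite cabsM ReiNIm /= expr0n expr1n /= !add0r sqrtr1 mulr1 opprK.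
  have := le_trans (Re_le_cabs _) h; rewrite /= ler_norml => /andP[_]; lra.
have s0E : (s j l0)`_0 = x%:C.
  apply: Im0E; apply/eqP; rewrite -normr_le0; apply/ler_addgt0Pl => e e0.
  by rewrite addr0; case: (ReIm e e0).
exists x; split; first by rewrite -s0E.
  by apply/ler_addgt0Pr => e e0; rewrite addrC -lerBlDl sub0r; case: (ReIm e e0).
near=> th.
have th_th0 : 0 < th < th0.
  by apply/andP; split; near: th; [exact: nbhs_right_gt|exact: nbhs_right_lt].
have [_ cX] := core th th_th0; apply/cvgrPdist_le => e e0.
apply: filterS (cX e e0) => n.
by rewrite s0E -rmorphB cabs_real distrC.
Unshelve. all: by end_near. Qed.
End Sidestep.

(** * Passage to Landau notation *)

Section Landau.
Variables (R : realType) (N : set nat).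
Implicit Types u v : nat -> R.

Lemma obnd_cvg0 u t : t < 0 -> obnd N u t -> u @ toinfty N --> (0 : R).
Proof.
move=> t0 ut; apply/cvgrPdist_le => e e0.
by apply: filterS (obnd_small t0 e0 ut) => n; rewrite sub0r normrN.
Qed.

Lemma cvg_seq_sum0 (I : choiceType) (r : seq I) (F : I -> nat -> R) :
  (forall i, i \in r -> F i @ toinfty N --> (0 : R)) ->
  \sum_(i <- r) F i n @[n --> toinfty N] --> (0 : R).
Proof.
elim: r => [|i r IHr] Fr.
  by under eq_fun do rewrite big_nil; exact: cvg_cst.
under eq_fun do rewrite big_cons.
have Fi : F i @ toinfty N --> (0 : R) by apply: Fr; rewrite mem_head.
have {}IHr : \sum_(l <- r) F l n @[n --> toinfty N] --> (0 : R).
  by apply: IHr => l lr; apply: Fr; rewrite in_cons lr orbT.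
have sum0 : (F i n + \sum_(l <- r) F l n) @[n --> toinfty N] --> (0 + 0 : R).
  exact: cvgD.
by rewrite addr0 in sum0.
Qed.

Lemma obnd_bigO u (j : nat) : obnd N u (- j%:R) ->
  u =O_ (toinfty N) (fun n => (n%:R : R) ^- j).
Proof.
move=> /obnd_ge0[C C0 uC]; apply/eqO_exP; exists (C + 1); first by rewrite ltr_wpDl.
near=> n.
have un : `|u n| <= C * n%:R `^ (- j%:R) by near: n.
apply: (le_trans un); rewrite ger0_norm ?invr_ge0 ?exprn_ge0 // powR_invn //.
by rewrite ler_wpM2r ?invr_ge0 ?exprn_ge0 // lerDl.
Unshelve. all: by end_near. Qed.

Lemma cvg_littleo u (j : nat) (x : R) :
  n%:R ^+ j * u n @[n --> toinfty N] --> x ->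
  u = (fun n => n%:R ^- j * x) +o_ (toinfty N) (fun n => (n%:R : R) ^- j).
Proof.
move=> ux; apply/eqaddoP => e e0; near=> n.
have n0 : (0 < n)%N by near: n; exact: toinfty_ge.
have nj0 : 0 < (n%:R : R) ^+ j by rewrite exprn_gt0 // ltr0n.
rewrite [X in _ <= _ * X]ger0_norm ?invr_ge0 ?(ltW nj0) // ler_pdivlMr //.
rewrite -[X in _ * X <= _](ger0_norm (ltW nj0)) -normrM.
have -> : (u - (fun n => n%:R ^- j * x)) n * n%:R ^+ j = n%:R ^+ j * u n - x.
  rewrite mulrC [LHS]mulrBr; congr (_ - _).
  by rewrite mulrA divff ?mul1r // gt_eqF.
rewrite distrC; near: n; by move/cvgrPdist_le: ux => /(_ e e0).
Unshelve. all: by end_near. Qed.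

Lemma cvg0_littleo u (j : nat) :
  n%:R ^+ j * u n @[n --> toinfty N] --> (0 : R) ->
  u =o_ (toinfty N) (fun n => (n%:R : R) ^- j).
Proof.
move=> /cvg_littleo uE; apply/eqoP; move/eqaddoP: uE.
suff -> : u - (fun n => n%:R ^- j * 0) = u by [].
apply/funext => n; rewrite [LHS](_ : _ = u n - n%:R ^- j * 0) //.
by rewrite mulr0 subr0.
Qed.
End Landau.

(** * Assembly of the two statements *)

Section Assembly.
Variables (R : realType) (La0 La1 : R) (N : set nat) (M : forall n, matrix_space R n).
Local Notation cabs := (@ComplexField.Normc.normc R).

Lemma Ein_setU n (S T : set R[i]) :
  Ein (M n) (S `|` T) <= Ein (M n) S + Ein (M n) T.
Proof.
rewrite !Ein_spec_mean -spec_meanD; apply: le_spec_mean => A _ z _.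
have [[Sz|Tz]|_] := asboolP ((S `|` T) z); last by rewrite addr_ge0.
  by rewrite (asboolT Sz) lerDl.
by rewrite (asboolT Tz) lerDr.
Qed.

Lemma le_Ein n (S T : set R[i]) : S `<=` T -> Ein (M n) S <= Ein (M n) T.
Proof.
move=> ST; rewrite !Ein_spec_mean; apply: le_spec_mean => A _ z _.
have [Sz|_] := asboolP (S z); last by rewrite ler0n.
by rewrite (asboolT (ST _ Sz)).
Qed.

Lemma Ein_bigcup n (r : seq R[i]) (F : R[i] -> set R[i]) :
  Ein (M n) (\bigcup_(l in [set` r]) F l) <= \sum_(l <- r) Ein (M n) (F l).
Proof.
elim: r => [|l r IHr]; rewrite ?big_nil ?big_cons.
  rewrite Ein_spec_mean (_ : (fun _ => _) = fun=> 0) ?spec_mean_cst ?mul0r //.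
  by apply/funext => z; case: asboolP => // -[l].
apply: (le_trans (le_Ein n (T := F l `|` \bigcup_(l in [set` r]) F l) _)).
  move=> z [l' /=]; rewrite in_cons => /predU1P[->|l'r] Fz; first by left.
  by right; exists l'.
by apply: (le_trans (Ein_setU _ _ _)); rewrite lerD2l.
Qed.

(** Applied with [U] the bases of all coefficients used in the outer estimate and [L] those of [p j]
    alone. *)
Lemma Eout_cnbhd_le n (D : set R[i]) (d : R) (L U : {fset R[i]}) :
  Eout (M n) (D `|` cnbhd d [set` L]) <=
  Eout (M n) (D `|` cnbhd d [set` U])
  + \sum_(l <- (U `\` L)%fset) Ein (M n) (cdisk d l).
Proof.
apply: le_trans (lerD (lexx _) (Ein_bigcup n (U `\` L)%fset (cdisk d))).
apply: le_trans (Ein_setU _ _ _); apply: le_Ein => z zL.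
have [[Dz|[l /= lU zl]]|zU] := pselect ((D `|` cnbhd d [set` U]) z); last by left.
  by case: zL; left.
right; exists l => //=; rewrite in_fsetD lU andbT; apply/negP => lL.
by case: zL; right; exists l.
Qed.

(** Each [c i] may come from an expansion of its own order; uniqueness of coefficients lets them all
    stand in one expansion of any order [r]. *)
Lemma expansion_data (c p : nat -> nat -> R[i]) : 0 <= La0 ->
  infinite_set N ->
  (forall r, (0 < r)%N -> exists c', has_expansion La0 La1 N M r c') ->
  (forall i, coefficient La0 La1 N M i (c i)) ->
  (forall i, polyexp_part La0 (c i) (p i)) ->
  (forall r, (0 < r)%N -> exists K cr (D : R),
    [/\ (K n)%:R / ln (n%:R : R) @[n --> toinfty N] --> +oo,
      has_growth La1 cr, 0 <= D &
      forall n k, N n -> (1 <= k <= K n)%N ->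
        cabs ((mean_trace M n k)%:C - \sum_(i < r) c i k / n%:R ^+ i)
        <= D * cabs (cr k) / n%:R ^+ r]) /\
  forall i L, bases (p i) L -> forall l, l \in L -> complex.Im l = 0.
Proof.
move=> La0_ge0 Ninf Mexp ccoef ppart; split=> [r r0|i L pL l lL].
  have [c' c'exp] := Mexp r r0.
  have cc' i k : (i < r)%N -> (0 < k)%N -> c i k = c' i k.
    move=> ir k0; have [ri [ci [iri ciexp ->//]]] := ccoef i.
    exact: (expansion_uniq Ninf k0 iri ir ciexp c'exp).
  case: c'exp => K [cr [_ Koo oexp]]; have [D D0 Dbound] := order_expansion_bound oexp.
  exists K, cr, D; split=> //; first by case: oexp.
  move=> n k Nn kK; have k0 : (0 < k)%N by case/andP: kK.
  have -> : \sum_(i < r) c i k / n%:R ^+ i = \sum_(i < r) c' i k / n%:R ^+ i.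
    by apply: eq_bigr => i _; rewrite cc'.
  exact: Dbound.
have [r [c' [ir [K [cr [_ _ [_ _ oexp]]]] cc']]] := ccoef i.
have [_ Lint] := oexp i ir.
have c'part : polyexp_part La0 (c' i) (p i).
  have [pb [g gg gE]] := ppart i; split=> //.
  by exists g => // k k0; rewrite -cc' // gE.
rewrite (larger_basesE La0_ge0 c'part pL) in Lint.
by have [x _ <-] := Lint l lL.
Qed.

End Assembly.

Theorem theorem2p4 (R : realType) (La0 La1 : R) (N : set nat)
    (M : forall n, matrix_space R n) (c p : nat -> nat -> R[i])
    (La0_gt0 : 0 < La0) (La0_lt_La1 : La0 < La1)
    (Mbounded : bounded_model La0 La1 N M)
    (Mexpansion : forall r, (0 < r)%N ->
       exists c', has_expansion La0 La1 N M r c')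
    (c_coef : forall i, coefficient La0 La1 N M i (c i))
    (p_part : forall i, polyexp_part La0 (c i) (p i)) :
  ((forall i k, (0 < k)%N -> p i k = 0) ->
   forall (e : R) (j : nat), 0 < e ->
     (fun n => Eout (M n) (cdisk (La0 + e) 0))
       =O_ (toinfty N) (fun n => (n%:R : R) ^- j))
  /\
  (forall (j : nat) (L : {fset R[i]}),
   (exists2 k, (0 < k)%N & p j k != 0) ->
   (forall i, (i < j)%N -> forall k, (0 < k)%N -> p i k = 0) ->
   bases (p j) L ->
   [/\ larger_bases_upto La0 c j.+1 = [set` L], L != fset0,
     (forall e : R, 0 < e -> \forall theta \near (0 : R)^'+,
        (fun n => Eout (M n)
           (cdisk (La0 + e) 0 `|`
            cnbhd (n%:R `^ (- theta)) (larger_bases_upto La0 c j.+1)))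
          =o_ (toinfty N) (fun n => (n%:R : R) ^- j)) &
     exists C : R[i] -> R,
       [/\ (forall l, l \in L -> 0 < C l),
           (forall k, (0 < k)%N -> p j k = \sum_(l <- L) l ^+ k * (C l)%:C) &
           (forall l, l \in L -> \forall theta \near (0 : R)^'+,
              (fun n => Ein (M n) (cdisk (n%:R `^ (- theta)) l))
                = (fun n => n%:R ^- j * C l)
                  +o_ (toinfty N) (fun n => (n%:R : R) ^- j))]]).
Proof.
have La0_ge0 := ltW La0_gt0; have Ninf : infinite_set N by case: Mbounded.
have [expansions Lreal] := expansion_data La0_ge0 Ninf Mexpansion c_coef p_part.
have /choice[Ls LsP] : forall i,
    exists x : {fset R[i]} * (R[i] -> {poly R[i]}) * (nat -> R[i]),
    [/\ bases (p i) x.1.1, poly_repr (p i) x.1.1 x.1.2,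
      forall l, l \in x.1.1 -> La0 < ComplexField.Normc.normc l,
      has_growth La0 x.2 & forall k, (0 < k)%N -> c i k = p i k + x.2 k].
  move=> i; have [L [s [g h]]] := polyexp_part_repr La0_ge0 (p_part i).
  by exists (L, s, g).
pose Lb i := (Ls i).1.1; pose s i := (Ls i).1.2; pose g i := (Ls i).2.
have Lb_bases i : bases (p i) (Lb i) by case: (LsP i).
have p_repr i : poly_repr (p i) (Lb i) (s i) by case: (LsP i).
have Lb_gt i l : l \in Lb i -> La0 < ComplexField.Normc.normc l
  by case: (LsP i) => _ _ h _ _; exact: h.
have g_growth i : has_growth La0 (g i) by case: (LsP i).
have cE i k : (0 < k)%N -> c i k = p i k + g i k
  by case: (LsP i) => _ _ _ _ h; exact: h.
have Lb_real i l : l \in Lb i -> complex.Im l = 0 by exact: Lreal (Lb_bases i) l.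
have Lb0 i : (forall k, (0 < k)%N -> p i k = 0) -> Lb i = fset0.
  move=> pi0; apply/eqP; rewrite -[_ == _]negbK; apply/negP => /fset0Pn[l lL].
  have [sL _] := p_repr i; move: (lL); rewrite -sL => /eqP; apply.
  apply: (@expterm_sum_growth R (Lb i) (s i) La0 (fun=> 0)) lL => //.
  - exact: Lb_gt.
  - exact: (has_growth_cst0 La0_ge0).
  - by near=> k; rewrite -(proj2 (p_repr i)) ?pi0 //; near: k; exact: nbhs_infty_gt.
have out := Eout_obnd La0_gt0 La0_lt_La1 Mbounded expansions p_repr g_growth cE.
have limit := Ein_limit La0_gt0 La0_lt_La1 Mbounded expansions p_repr Lb_real g_growth cE.
split=> [p0 e j e0|j L [k0 k0_gt0 pk0] pj0 pL].
  (* When all [p i] vanish there are no bases, so the empty set is admissible and no neighbourhoods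
     are excluded. *)
  have [r0 /(_ r0 (leqnn _) fset0)] := out e j e0.
  case=> [i _|l|th0 th00 /(_ (th0 / 2))].
  - by rewrite Lb0 // => k k0; exact: p0.
  - by rewrite in_fset0.
  have th02 : 0 < th0 / 2 < th0.
    by rewrite divr_gt0 //= ltr_pdivrMr // mulr2n mulrDr mulr1 ltrDl.
  move=> /(_ th02) /obnd_bigO.
  suff setE d : cdisk (La0 + e) 0 `|` cnbhd d [set` fset0] = cdisk (La0 + e) 0.
    by under eq_fun do rewrite setE.
  apply/seteqP; split=> [z [//|[l]]|z]; last by left.
  by rewrite /= in_fset0.
have zero_notin i : 0 \notin Lb i.
  by apply/negP => /Lb_gt; rewrite cabs0 ltNge La0_ge0.
have LE : L = Lb j := bases_uniq (zero_notin j) (Lb_bases j) pL.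
have upto : larger_bases_upto La0 c j.+1 = [set` L].
  apply/seteqP; split=> l; last first.
    by move=> lL; exists j => //=; rewrite (larger_basesE La0_ge0 (p_part j) pL).
  case=> h /=; rewrite (larger_basesE La0_ge0 (p_part h) (Lb_bases h)) /= ltnS.
  rewrite leq_eqVlt => /predU1P[->|hj]; first by rewrite LE.
  by rewrite Lb0 ?in_fset0 // => k; exact: pj0.
have pj0' i k : (i < j)%N -> (0 < k)%N -> p i k = 0 by move=> ij; exact: pj0.
have Lgt l : l \in L -> La0 < ComplexField.Normc.normc l by rewrite LE; exact: Lb_gt.
have Lre l : l \in L -> complex.Im l = 0 by rewrite LE; exact: Lb_real.
split=> //.
- apply: contraNneq pk0 => L0; rewrite (proj2 (p_repr j)) // -LE L0.
  by rewrite big_seq_fset0.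
(* The exponent [j.+1] turns the [O] estimate into [o(n^-j)]. *)
- move=> e e0; have [r r_out] := out e j.+1 e0.
  have [U [LU UL]] := bases_union Lb r.
  have Ureal l : l \in U -> complex.Im l = 0.
    by move=> lU; have [i li] := UL l lU; exact: Lb_real li.
  have [th0 th00 th0_out] := r_out r (leqnn r) U LU Ureal.
  have nearU : \forall th \near (0 : R)^'+, forall l, l \in (U `\` L)%fset ->
      n%:R ^+ j * Ein (M n) (cdisk (n%:R `^ (- th)) l) @[n --> toinfty N] --> (0 : R).
    suff : \forall th \near (0 : R)^'+, (\bigcap_(l in [set` (U `\` L)%fset])
      [set th : R | n%:R ^+ j * Ein (M n) (cdisk (n%:R `^ (- th)) l)
        @[n --> toinfty N] --> (0 : R)]) th.
      by apply: filterS => th h l lUL; exact: (h l lUL).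
    (* Finitely many bases, so one range of theta serves them all. Outside [L] the term of [p j] is
       zero, and so is the limit of the scaled counts. *)
    apply: filter_bigI => l; rewrite in_fsetD => /andP[lL lU].
    have [i li] := UL l lU.
    have [x [sx _ xlim]] := limit l j (Lb_real i l li) (Lb_gt i l li) pj0'.
    have s0 : s j l = 0.
      by apply/eqP; rewrite -[_ == _]negbK (proj1 (p_repr j)) -LE.
    have x0 : x = 0.
      by apply: complexI; apply: polyC_inj; rewrite -sx s0 polyC0.
    by rewrite x0 in xlim.
  near=> th; rewrite upto; apply: cvg0_littleo.
  have th_th0 : 0 < th < th0.
    by apply/andP; split; near: th; [exact: nbhs_right_gt|exact: nbhs_right_lt].
  have outU := th0_out th th_th0.
  have ULlim : forall l, l \in (U `\` L)%fset ->
      n%:R ^+ j * Ein (M n) (cdisk (n%:R `^ (- th)) l) @[n --> toinfty N] --> (0 : R).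
    by near: th.
  apply: (@squeeze_cvgr _ _ _ _ (fun=> 0) (fun n => n%:R ^+ j * Eout (M n)
      (cdisk (La0 + e) 0 `|` cnbhd (n%:R `^ (- th)) [set` U])
      + \sum_(l <- (U `\` L)%fset) n%:R ^+ j * Ein (M n) (cdisk (n%:R `^ (- th)) l))).
  + near=> n; rewrite mulr_ge0 ?exprn_ge0 ?Ein_ge0 //= -mulr_sumr -mulrDr.
    by rewrite ler_wpM2l ?exprn_ge0 // Eout_cnbhd_le.
  + exact: cvg_cst.
  + have outU0 : n%:R ^+ j * Eout (M n) (cdisk (La0 + e) 0 `|`
        cnbhd (n%:R `^ (- th)) [set` U]) @[n --> toinfty N] --> (0 : R).
      apply: (@obnd_cvg0 _ _ _ (-1)); first by rewrite oppr_lt0.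
      by apply: obndW (obndM (obnd_natX _ _ j) outU); rewrite -natr1; lra.
    apply: (@cvg_trans _ (nbhs (0 + 0 : R))); last by rewrite addr0.
    exact: (cvgD outU0 (cvg_seq_sum0 ULlim)).
exists (fun l => complex.Re (s j l)`_0).
have sC l : l \in L -> exists x : R, [/\ s j l = (x%:C)%:P, 0 < x,
    complex.Re (s j l)`_0 = x & \forall th \near (0 : R)^'+,
      n%:R ^+ j * Ein (M n) (cdisk (n%:R `^ (- th)) l) @[n --> toinfty N] --> x].
  move=> lL; have [x [sx x0 xlim]] := limit l j (Lre l lL) (Lgt l lL) pj0'.
  exists x; split=> //; last by rewrite sx coefC.
  (* A zero limit would kill the term at [l], although [l] is a base of [p j]. *)
  rewrite lt_def x0 andbT; apply/negP => /eqP xz.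
  by move: (lL); rewrite LE -(proj1 (p_repr j)) sx xz polyC0 eqxx.
split=> [l lL|k kgt0|l lL].
- by have [x [_ x0 -> _]] := sC l lL.
- rewrite (proj2 (p_repr j)) // -LE big_seq [RHS]big_seq; apply: eq_bigr => l lL.
  by have [x [sx _ -> _]] := sC l lL; rewrite /expterm sx hornerC mulrC.
have [x [_ _ -> xlim]] := sC l lL.
by apply: filterS xlim => th; exact: cvg_littleo.
Unshelve. all: by end_near. Qed.
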